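(* Let $K\subset\mathbb R^2$ be a polygonal element with unit outward normal $\bm n$, let $V(K)\subset H^1(K)$ be a finite-dimensional space of scalar polynomial functions, $\bm W(K)\subset\bm H(\mathrm{curl};K)$ a finite-dimensional space of vector polynomial functions, and $\bm M(\partial K)$ a finite-dimensional space of vector-valued functions on $\partial K$ (with $\bm M(\partial K)|_F=\bm M(F)\subset\bm L^2(F)$ on each edge $F$). Then $V(K)\times\bm W(K)$ admits an $M$-decomposition if and only if all of the following hold: (i) $\bm n\times V(K)\subset\bm M(\partial K)$ and $\bm n\times\bm W(K)\times\bm n\subset\bm M(\partial K)$; (ii) $\nabla\times V(K)\subset\bm W(K)$ and $\nabla\times\bm W(K)\subset V(K)$; (iii) $I_M(V(K)\times\bm W(K))=0$; (iv) for every $\bm\mu\in\bm M(\partial K)$, $\bm n\times\bm\mu=0$ implies $\bm\mu=\bm 0$.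
   Context: Two-dimensional curl and cross-product conventions: for a vector field $\bm v=(v_1,v_2)^T$, $\nabla\times\bm v=-\partial_y v_1+\partial_x v_2$ (scalar); for a scalar $p$, $\nabla\times p=(\partial_y p,-\partial_x p)^T$. For a unit vector $\bm n=(n_1,n_2)$: $\bm n\times\bm v=-n_2v_1+n_1v_2$ (scalar), $\bm n\times p=(n_2p,-n_1p)^T$, and $\bm n\times\bm w\times\bm n:=\bm w-(\bm w\cdot\bm n)\bm n$ (tangential component). Functions are complex valued; $\perp$ denotes $L^2(K)$-orthogonal complement. Combined trace: $\mathrm{tr}(v,\bm w):=(\bm n\times v+\bm n\times\bm w\times\bm n)|_{\partial K}$. Definition: $V(K)\times\bm W(K)$ admits an $M$-decomposition if (a) $\bm n\times V(K)\subset\bm M(\partial K)$ and $\bm n\times\bm W(K)\times\bm n\subset\bm M(\partial K)$; and there exist subspaces $\widetilde V(K)\subset V(K)$, $\widetilde{\bm W}(K)\subset\bm W(K)$ such that (b) $\nabla\times V(K)\subset\widetilde{\bm W}(K)$ and $\nabla\times\bm W(K)\subset\widetilde V(K)$; (c) $\mathrm{tr}:\widetilde V^\perp(K)\times\widetilde{\bm W}^\perp(K)\to\bm M(\partial K)$ is an isomorphism, where $\widetilde V^\perp(K)$, $\widetilde{\bm W}^\perp(K)$ are the $L^2(K)$-orthogonal complements of $\widetilde V(K)$ in $V(K)$ and of $\widetilde{\bm W}(K)$ in $\bm W(K)$; (d) for every $\bm\mu\in\bm M(\partial K)$, $\bm n\times\bm\mu=0$ implies $\bm\mu=\bm 0$.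 The spaces $\widetilde V(K),\widetilde{\bm W}(K)$ are called the associated spaces. $M$-index: $I_M(V(K)\times\bm W(K)):=\dim\bm M(\partial K)-\dim\{\bm n\times v|_{\partial K}: v\in V(K),\ \nabla\times v=\bm 0\}-\dim\{\bm n\times\bm w\times\bm n|_{\partial K}:\bm w\in\bm W(K),\ \nabla\times\bm w=0\}$. *)

(* Defs.v *)
(* MathComp + MathComp-Analysis (R : realType), complex numbers R[i]
   from mathcomp-real-closed. *)
From HB Require Import structures.
From mathcomp Require Import all_boot all_order all_algebra.
From mathcomp Require Import all_classical all_reals all_analysis.
From mathcomp.real_closed Require Import complex.
Import numFieldNormedType.Exports.

Set Implicit Arguments.
Unset Strict Implicit.
Unset Printing Implicit Defensive.
Import Order.TTheory GRing.Theory Num.Theory.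
Local Open Scope classical_set_scope.
Local Open Scope ring_scope.

(* Finite-dimensional linear algebra (spaces = spans of finite lists,  *)
(* dimensions computed modulo a "null" subspace, e.g. a.e.-zero).      *)
Section Lin.
(* T : additive group with a scalar action sc of the field F *)
Variables (F : fieldType) (T : zmodType) (sc : F -> T -> T).

Definition lincomb (s : seq T) (c : nat -> F) : T :=
  \sum_(i < size s) sc (c i) s`_i.

(* the subspace spanned by the finite list s *)
Definition span (s : seq T) : set T := [set x | exists c, x = lincomb s c].

(* s is linearly independent modulo the null set Z *)
Definition indep_mod (Z : set T) (s : seq T) : Prop :=
  forall c, Z (lincomb s c) -> forall i, (i < size s)%N -> c i = 0.

(* the (image in T/Z of the) set S has dimension d *)
Definition has_dim_mod (Z : set T) (S : set T) (d : nat) : Prop :=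
  (exists s : seq T, size s = d /\ (forall i, (i < size s)%N -> S s`_i)
                     /\ indep_mod Z s) /\
  (forall s : seq T, (forall i, (i < size s)%N -> S s`_i) ->
                     indep_mod Z s -> (size s <= d)%N).
End Lin.

(* complex scalar polynomials in (x,y): outer variable = x, inner = y *)
Notation Pol R := {poly {poly R[i]}}.
(* functions on the boundary: edge index j and edge parameter t in (0,1) *)
Notation BF R m := ('I_m * R -> R[i] * R[i])%type.

Section Setting.
Variable R : realType.
Local Notation C := R[i].

(* complex scalar multiplication on scalar / vector polynomials *)
Definition scP (c : C) (p : Pol R) : Pol R := (c%:P)%:P * p.
Definition scW (c : C) (w : Pol R * Pol R) : Pol R * Pol R := (scP c w.1, scP c w.2).
Definition spanP := span scP.
Definition spanW := span scW.

Definition peval (p : Pol R) (x : R * R) : C := p.[(x.1%:C)%C, (x.2%:C)%C].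

Definition dX (p : Pol R) : Pol R := p^`().
Definition dY (p : Pol R) : Pol R := map_poly deriv p.

(* 2D curls *)
Definition curl_s (v : Pol R) : Pol R * Pol R := (dY v, - dX v).
Definition curl_v (w : Pol R * Pol R) : Pol R := - dY w.1 + dX w.2.

Variable m : nat.
Variable a : 'I_m -> R * R.   (* vertices, edge j goes from a j to a (ordS j) *)

Definition ept (j : 'I_m) (t : R) : R * R :=
  ((a j).1 + t * ((a (ordS j)).1 - (a j).1),
   (a j).2 + t * ((a (ordS j)).2 - (a j).2)).

(* closed edge j *)
Definition seg (j : 'I_m) : set (R * R) := ept j @` (`[0, 1] : set R).

(* K is the (open) polygonal domain bounded by the simple closed polygon a *)
Definition is_polygon (K : set (R * R)) : Prop :=
  [/\ (3 <= m)%N,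
      (forall j, a j <> a (ordS j)),
      (forall j k x, j <> k -> seg j x -> seg k x ->
          (k = ordS j /\ x = a k) \/ (j = ordS k /\ x = a j)) &
      [/\ open K, connected K,
      (exists r : R, forall x, K x -> `|x.1| <= r /\ `|x.2| <= r) &
      closure K `\` K = \bigcup_j seg j] ].

(* n j is the unit outward normal on edge j *)
Definition unit_outward_normal (K : set (R * R)) (n : 'I_m -> R * R) : Prop :=
  forall j,
  [/\ (n j).1 ^+ 2 + (n j).2 ^+ 2 = 1,
      (n j).1 * ((a (ordS j)).1 - (a j).1) + (n j).2 * ((a (ordS j)).2 - (a j).2) = 0 &
      forall t, 0 < t < 1 -> exists2 e : R, 0 < e & forall s, 0 < s < e ->
        ~ K ((ept j t).1 + s * (n j).1, (ept j t).2 + s * (n j).2) /\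
          K ((ept j t).1 - s * (n j).1, (ept j t).2 - s * (n j).2)].

(* a.e.-zero (w.r.t. arc length) on every edge *)
Definition bnull (V : zmodType) (f : 'I_m * R -> V) : Prop :=
  forall j, (@lebesgue_measure R).-negligible [set t | 0 < t < 1 /\ f (j, t) <> 0].

Definition sqmod (z : C) : R := complex.Re z ^+ 2 + complex.Im z ^+ 2.

(* mu lies in L^2 on every edge *)
Definition L2_edges (mu : BF R m) : Prop :=
  forall j,
  [/\ measurable_fun (`[0, 1] : set R) (fun t => complex.Re (mu (j, t)).1),
      measurable_fun (`[0, 1] : set R) (fun t => complex.Im (mu (j, t)).1),
      measurable_fun (`[0, 1] : set R) (fun t => complex.Re (mu (j, t)).2),
      measurable_fun (`[0, 1] : set R) (fun t => complex.Im (mu (j, t)).2) &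
      (@lebesgue_measure R).-integrable (`[0, 1] : set R)
        (fun t => (sqmod (mu (j, t)).1 + sqmod (mu (j, t)).2)%:E)].

Variable n : 'I_m -> R * R.

(* n x v  (scalar v -> vector) on the boundary *)
Definition ncross_s (v : Pol R) : BF R m := fun jt =>
  let val := peval v (ept jt.1 jt.2) in
  (((n jt.1).2)%:C%C * val, - (((n jt.1).1)%:C%C * val)).

(* n x w x n = w - (w.n) n : tangential component on the boundary *)
Definition ntan (w : Pol R * Pol R) : BF R m := fun jt =>
  let x := ept jt.1 jt.2 in
  let n1 := ((n jt.1).1)%:C%C in let n2 := ((n jt.1).2)%:C%C in
  let w1 := peval w.1 x in let w2 := peval w.2 x in
  let d := n1 * w1 + n2 * w2 in
  (w1 - d * n1, w2 - d * n2).

(* n x mu (vector -> scalar) *)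
Definition ncross_b (mu : BF R m) : 'I_m * R -> C := fun jt =>
  - (((n jt.1).2)%:C%C * (mu jt).1) + ((n jt.1).1)%:C%C * (mu jt).2.

(* combined trace *)
Definition trc (v : Pol R) (w : Pol R * Pol R) : BF R m := ncross_s v + ntan w.

Definition scB (c : C) (f : BF R m) : BF R m := c *: f.
Definition spanB := span scB.

(* f belongs to M (as an element of L^2 on the edges) *)
Definition inM (sM : seq (BF R m)) (f : BF R m) : Prop :=
  exists2 mu, spanB sM mu & bnull (f - mu).

Variable K : set (R * R).

(* complex-valued integral over K w.r.t. 2D Lebesgue measure *)
Definition cintK (f : R * R -> C) : C :=
  (Rintegral (@lebesgue_measure R \x @lebesgue_measure R)%E K (fun x => complex.Re (f x)))%:C%C
  + 'i%C * (Rintegral (@lebesgue_measure R \x @lebesgue_measure R)%E K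
                       (fun x => complex.Im (f x)))%:C%C.

(* L^2(K) inner products *)
Definition ipS (p q : Pol R) : C := cintK (fun x => peval p x * (peval q x)^*).
Definition ipV (w z : Pol R * Pol R) : C := ipS w.1 z.1 + ipS w.2 z.2.

(* L^2(K)-orthogonal complements of span st in span s *)
Definition perpS (s st : seq (Pol R)) : set (Pol R) :=
  [set v | spanP s v /\ forall u, spanP st u -> ipS v u = 0].
Definition perpV (s st : seq (Pol R * Pol R)) : set (Pol R * Pol R) :=
  [set w | spanW s w /\ forall z, spanW st z -> ipV w z = 0].

(* Definition of an M-decomposition, with V = spanP sV, W = spanW sW,
   M = spanB sM (modulo a.e. equality on edges) *)
Definition M_decomposition (sV : seq (Pol R)) (sW : seq (Pol R * Pol R))
    (sM : seq (BF R m)) : Prop :=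
  [/\ (* (a) *)
      (forall v, spanP sV v -> inM sM (ncross_s v)) /\
      (forall w, spanW sW w -> inM sM (ntan w)),
      (* (b), (c) with associated spaces spanP sVt, spanW sWt *)
      exists sVt : seq (Pol R), exists sWt : seq (Pol R * Pol R),
        [/\ (forall v, spanP sVt v -> spanP sV v) /\
            (forall w, spanW sWt w -> spanW sW w),
            (forall v, spanP sV v -> spanW sWt (curl_s v)),
            (forall w, spanW sW w -> spanP sVt (curl_v w)),
            (* tr injective on Vt^perp x Wt^perp *)
            (forall v w, perpS sV sVt v -> perpV sW sWt w ->
                 bnull (trc v w) -> v = 0 /\ w = 0) &
            (* tr onto M *)
            (forall mu, spanB sM mu -> exists v, exists w,
                 [/\ perpS sV sVt v, perpV sW sWt w & bnull (trc v w - mu)])] &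
      (* (d) *)
      (forall mu, spanB sM mu -> bnull (ncross_b mu) -> bnull mu)].

(* I_M(V x W) = 0 *)
Definition M_index_zero (sV : seq (Pol R)) (sW : seq (Pol R * Pol R))
    (sM : seq (BF R m)) : Prop :=
  exists dM dA dB : nat,
  [/\ has_dim_mod (@scB) (@bnull _) (spanB sM) dM,
      has_dim_mod (@scB) (@bnull _)
        [set f | exists2 v, spanP sV v /\ curl_s v = 0 & f = ncross_s v] dA,
      has_dim_mod (@scB) (@bnull _)
        [set f | exists2 w, spanW sW w /\ curl_v w = 0 & f = ntan w] dB &
      dM%:Z - dA%:Z - dB%:Z = 0].

End Setting.

(* Main.v *)
Require Import Defs.
From HB Require Import structures.
From mathcomp Require Import all_boot all_order all_algebra.
From mathcomp Require Import all_classical all_reals all_analysis.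
From mathcomp Require Import measurable_realfun zify ring lra.
From mathcomp.real_closed Require Import complex.
Import numFieldNormedType.Exports.
Import Order.TTheory GRing.Theory Num.Theory.
Local Open Scope classical_set_scope.
Local Open Scope ring_scope.

(** Let [Y] and [X] be the orthogonal complements of [curl W] in [V] and of
    [curl V] in [W], and let [W00] be the set of [w] in [W] with [curl w = 0] and
    [n x w = 0] on the boundary.  If [(v, w)] in [Y x X] has zero trace, Green's
    formula gives [|v|^2 = 0] on the boundary; then [n x w = 0] there as well, and
    two more integrations by parts give [curl v = 0] and [curl w = 0].  So the
    kernel of the trace on [Y x X] is [0 x W00], and rank-nullity shows that the
    dimension of its image is the sum of the two dimensions subtracted in the
    [M]-index.  The index is therefore zero exactly when the trace maps [Y x X]
    onto [M].  An [M]-decomposition implies this because the complements of the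
    associated spaces lie in [Y] and [X]; conversely [curl W] and [curl V + W00]
    are associated spaces.

    Green's formula is proved by Fubini: on a generic horizontal line, the
    indicator of [K] equals the sum, over the edges [j] crossing the line at
    abscissa [x_j], of [sgn (n_j)_1] times the indicator of [x < x_j], because
    the difference is locally constant across every [x_j] and vanishes far away. *)

Set Implicit Arguments.
Unset Strict Implicit.
Unset Printing Implicit Defensive.

(** * Dimensions modulo a null space *)

(** The polygon is given only topologically, by its boundary and by a normal condition along single
    lines, with no triangulation and no orientation. The divergence theorem therefore rests on two
    local facts: membership in [K] is constant near a point off the boundary, and near an interior
    point of an edge [K] agrees, off that edge, with the half plane opposite to the normal. The
    shape of [K] at a vertex is never examined, because the vertices lie on finitely many horizontal
    lines.

    Integrals over [K] are computed only for monomials and extended by linearity. Edge integrals are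
    those of polynomials in the edge parameter, so a trace that vanishes almost everywhere becomes a
    polynomial identity.

    The boundary term in Green's formula pairs [n x w] with the conjugate of [v]. A zero trace means
    [n x w = v], which turns it into [|v|^2], while orthogonality kills the volume terms. By (ii)
    the curls of [v] and [w] are themselves admissible test functions, which is what the two further
    integrations by parts use.

    Boundary functions count only up to null sets, so dimensions are taken modulo a subspace,
    without forming quotients. *)

Section Lincomb.
Variables (F : fieldType) (T : lmodType F).
Local Notation lc := (lincomb (@GRing.scale F T)).
Implicit Types (s t : seq T) (S Z : set T).

(** Subspaces are plain sets because the ambient spaces of polynomials and of boundary functions are
    infinite-dimensional. *)
Definition subspace_set S := S 0 /\ forall c x y, S x -> S y -> S (c *: x + y).

Lemma subspace_setB S x y : subspace_set S -> S x -> S y -> S (x - y).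
Proof. by case=> _ hS Sx Sy; rewrite addrC -scaleN1r; exact: hS. Qed.

Lemma subspace_setD S x y : subspace_set S -> S x -> S y -> S (x + y).
Proof. by case=> _ hS Sx Sy; rewrite -[x]scale1r; exact: hS. Qed.

Lemma subspace_setZ S c x : subspace_set S -> S x -> S (c *: x).
Proof. by case=> S0 hS Sx; rewrite -[_ *: _]addr0; exact: hS. Qed.

Lemma subspace_set_sum S (I : finType) (g : I -> T) :
  subspace_set S -> (forall i, S (g i)) -> S (\sum_i g i).
Proof.
move=> hS hg; elim/big_ind: _ => //; first by case: hS.
by move=> x y; exact: subspace_setD.
Qed.

Lemma subspace_set1 : subspace_set [set (0 : T)].
Proof. by split=> // c x y /= -> ->; rewrite scaler0 addr0. Qed.

Lemma subspace_setI S S' : subspace_set S -> subspace_set S' -> subspace_set (S `&` S').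
Proof.
move=> [S0 hS] [S'0 hS']; split=> // c x y [Sx S'x] [Sy S'y].
by split; [exact: hS|exact: hS'].
Qed.

Lemma lincombE s c : lc s c = \sum_(i < size s) c i *: s`_i.
Proof. by []. Qed.

Lemma lincomb_in S s c : subspace_set S ->
  (forall i, (i < size s)%N -> S s`_i) -> S (lc s c).
Proof.
by move=> hS hs; apply: subspace_set_sum => // i; apply: subspace_setZ => //; exact: hs.
Qed.

Lemma eq_lincomb s c c' : (forall i, (i < size s)%N -> c i = c' i) -> lc s c = lc s c'.
Proof. by move=> h; apply: eq_bigr => i _; rewrite h. Qed.

Lemma lincomb0 s : lc s (fun=> 0) = 0.
Proof. by rewrite /lincomb big1// => i _; rewrite scale0r. Qed.

Lemma lincombD s a c c' : lc s (fun i => a * c i + c' i) = a *: lc s c + lc s c'.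
Proof.
rewrite !lincombE scaler_sumr -big_split; apply: eq_bigr => i _ /=.
by rewrite scalerDl scalerA.
Qed.

Lemma lincomb_cat s t c :
  lc (s ++ t) c = lc s c + lc t (fun i => c (size s + i)%N).
Proof.
rewrite !lincombE size_cat big_split_ord/=; congr (_ + _); apply: eq_bigr => i _ /=.
  by rewrite nth_cat ltn_ord.
by rewrite nth_cat ltnNge leq_addr/= addKn.
Qed.

Lemma lincomb_seq1 x c : lc [:: x] c = c 0%N *: x.
Proof. by rewrite lincombE big_ord1. Qed.

Lemma lincomb_rcons s x c : lc (rcons s x) c = lc s c + c (size s) *: x.
Proof. by rewrite -cats1 lincomb_cat lincomb_seq1 addn0. Qed.

Lemma subspace_span s : subspace_set (Defs.span (@GRing.scale F T) s).
Proof.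
split; first by exists (fun=> 0); rewrite lincomb0.
by move=> a _ _ [c ->] [c' ->]; exists (fun i => a * c i + c' i); rewrite lincombD.
Qed.

Lemma mem_span s i : (i < size s)%N -> Defs.span (@GRing.scale F T) s s`_i.
Proof.
move=> hi; exists (fun k => (k == i)%:R); rewrite lincombE (bigD1 (Ordinal hi))//= eqxx.
rewrite scale1r big1 ?addr0// => k; rewrite -val_eqE/= => /negbTE ->.
by rewrite scale0r.
Qed.

Section Mod.
Variable Z : set T.
Hypothesis hZ : subspace_set Z.

(* If [size s < size t], the coordinate matrix of [t] in [s] has a nonzero left kernel. *)
Lemma indep_size_le s t :
    (forall i, (i < size t)%N -> exists c, Z (t`_i - lc s c)) ->
  indep_mod (@GRing.scale F T) Z t -> (size t <= size s)%N.
Proof.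
move=> hst ht; rewrite leqNgt; apply/negP => lt_st.
have /choice[c hc] (i : 'I_(size t)) : exists c, Z (t`_i - lc s c) by exact: hst.
pose M := \matrix_(i < size t, j < size s) c i j.
have : kermx M != 0.
  rewrite kermx_eq0 /row_free; apply: contraTneq lt_st => <-.
  by rewrite -leqNgt rank_leq_col.
move=> /rowV0Pn[u /sub_kermxP uM u0].
move/eqP: u0; apply; apply/rowP => i; rewrite mxE.
pose d k := if insub k is Some k' then u 0 k' else 0.
have dE (k : 'I_(size t)) : d k = u 0 k by rewrite /d valK.
rewrite -dE; apply: ht => //.
have -> : lc t d = \sum_i u 0 i *: (t`_i - lc s (c i)).
  under [RHS]eq_bigr => k _ do rewrite scalerBr.
  rewrite sumrB [X in _ - X](_ : _ = 0) ?subr0.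
    by rewrite lincombE; apply: eq_bigr => k _; rewrite dE.
  under eq_bigr => k _ do rewrite lincombE scaler_sumr.
  rewrite exchange_big/= big1// => j _.
  under eq_bigr => k _ do rewrite scalerA.
  rewrite -scaler_suml -[RHS](scale0r s`_j); congr (_ *: _).
  have /rowP/(_ j) := uM; rewrite mxE [RHS]mxE => uMj; rewrite -[RHS]uMj.
  by apply: eq_bigr => k _; rewrite mxE.
by apply: subspace_set_sum => // k; exact: subspace_setZ.
Qed.

Lemma dim_mod_intro S t : (forall i, (i < size t)%N -> S t`_i) ->
    indep_mod (@GRing.scale F T) Z t -> (forall x, S x -> exists c, Z (x - lc t c)) ->
  has_dim_mod (@GRing.scale F T) Z S (size t).
Proof.
move=> tS ht St; split; first by exists t.
by move=> s sS; apply: indep_size_le => i /sS /St.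
Qed.

Lemma indep_rcons s x : indep_mod (@GRing.scale F T) Z s ->
  ~ (exists c, Z (x - lc s c)) -> indep_mod (@GRing.scale F T) Z (rcons s x).
Proof.
move=> hs hx c; rewrite lincomb_rcons => Zc.
have c0 : c (size s) = 0.
  (* The summand [0] brings the coefficients into the shape of [lincombD]. *)
  apply: contrapT => /eqP c0; apply: hx; exists (fun i => - (c (size s))^-1 * c i + 0).
  rewrite lincombD lincomb0 addr0 scaleNr opprK.
  rewrite [X in Z X](_ : _ = (c (size s))^-1 *: (lc s c + c (size s) *: x)).
    exact: subspace_setZ.
  by rewrite scalerDr scalerA mulVf// scale1r addrC.
move=> i; rewrite size_rcons ltnS leq_eqVlt => /predU1P[->//|].
by apply: hs; move: Zc; rewrite c0 scale0r addr0.
Qed.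

(** A vector of [S] outside the span would extend the family by [indep_rcons], against
    maximality. *)
Lemma indep_max_span S s : (forall i, (i < size s)%N -> S s`_i) ->
    indep_mod (@GRing.scale F T) Z s ->
    (forall t, (forall i, (i < size t)%N -> S t`_i) -> indep_mod (@GRing.scale F T) Z t ->
       (size t <= size s)%N) ->
  forall x, S x -> exists c, Z (x - lc s c).
Proof.
move=> sS hs smax x Sx; apply: contrapT => /(indep_rcons hs)/smax.
rewrite size_rcons ltnn => h; suff: false by []. apply: h => i.
rewrite ltnS leq_eqVlt nth_rcons => /predU1P[->|hi]; first by rewrite ltnn eqxx.
by rewrite hi; exact: sS.
Qed.

Lemma dim_mod_uniq S d d' : has_dim_mod (@GRing.scale F T) Z S d ->
  has_dim_mod (@GRing.scale F T) Z S d' -> d = d'.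
Proof.
move=> [[s [<- [sS hs]]] smax] [[t [<- [tS ht]]] tmax].
by apply/eqP; rewrite eqn_leq tmax// smax.
Qed.

(** By [indep_size_le] independent families in [S] have length at most [size s], so there is a
    longest one. *)
Lemma dim_mod_exists S s : (forall x, S x -> Defs.span (@GRing.scale F T) s x) ->
  exists d, has_dim_mod (@GRing.scale F T) Z S d.
Proof.
move=> Ss.
pose P k := exists t, [/\ size t = k, forall i, (i < size t)%N -> S t`_i &
  indep_mod (@GRing.scale F T) Z t].
have hP t : (forall i, (i < size t)%N -> S t`_i) -> indep_mod (@GRing.scale F T) Z t ->
    (size t <= size s)%N.
  move=> tS; apply: indep_size_le => i /tS /Ss[c ->]; exists c; rewrite subrr.
  by case: hZ.
have exP : exists k, `[< P k >] by exists 0%N; apply/asboolP; exists [::].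
have bP k : `[< P k >] -> (k <= size s)%N by move/asboolP => [t [<- tS /hP]]; exact.
case: (ex_maxnP exP bP) => d /asboolP[t [td tS ht]] dmax.
exists d; split; first by exists t.
by move=> t' t'S ht'; apply: dmax; apply/asboolP; exists t'.
Qed.

(** The preimage in [T] of the image of [S] in [T/Z]: it expresses agreement in the quotient as an
    equality of sets. *)
Definition saturation S : set T := [set x | exists2 y, S y & Z (x - y)].

Lemma dim_saturation S d : has_dim_mod (@GRing.scale F T) Z S d ->
  has_dim_mod (@GRing.scale F T) Z (saturation S) d.
Proof.
move=> [[s [<- [sS hs]]] smax]; apply: dim_mod_intro => //.
  by move=> i /sS Si; exists s`_i => //; rewrite subrr; case: hZ.
move=> x [y Sy Zxy]; have [c Zy] := indep_max_span sS hs smax Sy.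
by exists c; rewrite -(subrK y x) -addrA; exact: subspace_setD.
Qed.

Lemma dim_saturation_eq S S' d d' : saturation S = saturation S' ->
  has_dim_mod (@GRing.scale F T) Z S d -> has_dim_mod (@GRing.scale F T) Z S' d' -> d = d'.
Proof.
by move=> e /dim_saturation + /dim_saturation; rewrite e; exact: dim_mod_uniq.
Qed.

(** A basis of [S] is an independent family of maximal length in the saturation of [S'], and so
    spans it modulo [Z]. *)
Lemma dim_eq_sub S S' d : S `<=` saturation S' ->
    has_dim_mod (@GRing.scale F T) Z S d -> has_dim_mod (@GRing.scale F T) Z S' d ->
    subspace_set S ->
  S' `<=` saturation S.
Proof.
move=> SS' [[s [sd [sS hs]]] _] /dim_saturation[_ S'max] hS x S'x.
have [|||c Zc] := @indep_max_span (saturation S') s _ hs _ x.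
- by move=> i /sS; exact: SS'.
- by move=> t tS ht; rewrite sd; exact: S'max.
- by exists x => //; rewrite subrr; case: hZ.
by exists (lc s c) => //; exact: lincomb_in.
Qed.

End Mod.

Lemma dim_set0 : has_dim_mod (@GRing.scale F T) [set 0] [set 0] 0.
Proof.
apply: (@dim_mod_intro _ subspace_set1 _ [::]) => // x /= ->; exists (fun=> 0).
by rewrite lincomb0 subrr.
Qed.

End Lincomb.

Section RankNullity.
Variables (F : fieldType) (T T' : lmodType F) (f : T -> T').
Hypothesis fL : forall c x y, f (c *: x + y) = c *: f x + f y.

Lemma linear_lincomb s c :
  f (lincomb (@GRing.scale F T) s c) = lincomb (@GRing.scale F T') (map f s) c.
Proof.
pose g : {linear T -> T'} := HB.pack f (GRing.isLinear.Build _ _ _ _ f fL).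
rewrite -[f]/(g : _ -> _) !lincombE linear_sum size_map; apply: eq_bigr => i _.
by rewrite linearZ (nth_map 0).
Qed.

Lemma linear_sub x y : f (x - y) = f x - f y.
Proof. by rewrite addrC -scaleN1r fL scaleN1r addrC. Qed.

Lemma linear_image0 : f 0 = 0.
Proof. by rewrite -(subrr 0) linear_sub subrr. Qed.

Lemma subspace_preimage S : subspace_set S -> subspace_set (f @^-1` S).
Proof.
move=> hS; split; first by rewrite /preimage/= linear_image0; case: hS.
move=> c x y /= Sx Sy; rewrite fL; case: hS => _ hS'. exact: hS'.
Qed.

Lemma subspace_image S : subspace_set S -> subspace_set (f @` S).
Proof.
move=> hS; split; first by exists 0; [case: hS|exact: linear_image0].
by move=> c _ _ [x Sx <-] [y Sy <-]; exists (c *: x + y) => //; case: hS => _ hS'; exact: hS'.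
Qed.

(** This is rank-nullity for the map into [T'/Z'], whose kernel on [S] is cut out by the preimage of
    [Z']. The basis consists of a basis [s] of the kernel followed by lifts [u] of a basis [t] of
    the image. *)
Lemma rank_nullity (S : set T) (Z' : set T') k d : subspace_set S -> subspace_set Z' ->
    has_dim_mod (@GRing.scale F T) [set 0] (S `&` f @^-1` Z') k ->
    has_dim_mod (@GRing.scale F T') Z' (f @` S) d ->
  has_dim_mod (@GRing.scale F T) [set 0] S (k + d).
Proof.
move=> hS hZ' [[s [<- [sS hs]]] smax] [[t [<- [tS ht]]] tmax].
have sspan := indep_max_span (@subspace_set1 F T) sS hs smax.
have tspan := indep_max_span hZ' tS ht tmax.
have [u [su uS ut]] : exists u, [/\ size u = size t,
    (forall i, (i < size u)%N -> S u`_i) & map f u = t].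
  elim: t tS {ht tmax tspan} => [|x t IH] xtS; first by exists [::].
  have [u [su uS <-]] := IH (fun i => xtS i.+1).
  have [y Sy /= <-] := xtS 0%N isT.
  exists (y :: u); split; [by rewrite /= size_map|move=> [|i] hi//|by []].
  exact: uS.
rewrite -su -size_cat.
have fu c : f (lincomb (@GRing.scale F T) u c) = lincomb (@GRing.scale F T') t c.
  by rewrite linear_lincomb ut.
apply: dim_mod_intro => [|i|c|x Sx].
- exact: subspace_set1.
- rewrite size_cat nth_cat; case: (ltnP i (size s)) => [lt_is _|si hi]; first by case: (sS i lt_is).
  by apply: uS; rewrite ltn_subLR.
- rewrite lincomb_cat /= => h.
  (* Applying [f] sends the part along [s] into [Z'], which leaves a relation on [t] alone. *)
  have tc : forall i, (i < size t)%N -> c (size s + i)%N = 0.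
    apply: (ht (fun i => c (size s + i)%N)); rewrite -fu.
    move/eqP: h; rewrite addrC addr_eq0 => /eqP ->.
    rewrite -sub0r linear_sub linear_image0; apply: subspace_setB => //; first by case: hZ'.
    by apply: (@lincomb_in _ _ (f @^-1` Z')) => [|i hi]; [exact: subspace_preimage|case: (sS i hi)].
  have sc : forall i, (i < size s)%N -> c i = 0.
    apply: hs => /=; move: h; rewrite [X in _ + X](_ : _ = 0) ?addr0//.
    by rewrite -[RHS](lincomb0 u); apply: eq_lincomb => i; rewrite su => /tc.
  move=> i; rewrite size_cat; case: (ltnP i (size s)) => [/sc//|si hi].
  by rewrite -(subnKC si) tc// -su ltn_subLR.
- have [c Zc] : exists c, Z' (f x - lincomb (@GRing.scale F T') t c).
    by apply: tspan; exists x.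
  have [|c' /= hc'] := sspan (x - lincomb (@GRing.scale F T) u c).
    split; last by rewrite /preimage/= linear_sub fu.
    by apply: subspace_setB => //; exact: lincomb_in.
  exists (fun i => if (i < size s)%N then c' i else c (i - size s)%N).
  rewrite lincomb_cat /=.
  rewrite (@eq_lincomb _ _ s _ c') => [|i ->//].
  rewrite (@eq_lincomb _ _ u _ c) => [|i _]; last by rewrite ltnNge leq_addr addKn.
  by rewrite opprD addrA addrAC.
Qed.

End RankNullity.

Section DirectSum.
Variables (F : fieldType) (T T' : lmodType F).

Lemma linear_fst c (x y : T * T') : (c *: x + y).1 = c *: x.1 + y.1. Proof. by []. Qed.
Lemma linear_snd c (x y : T * T') : (c *: x + y).2 = c *: x.2 + y.2. Proof. by []. Qed.

(** Rank-nullity for the first projection; a second use, for the second projection, identifies its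
    kernel with [S']. *)
Lemma dim_setX (S : set T) (S' : set T') d d' : subspace_set S -> subspace_set S' ->
    has_dim_mod (@GRing.scale F T) [set 0] S d ->
    has_dim_mod (@GRing.scale F T') [set 0] S' d' ->
  has_dim_mod (@GRing.scale F (T * T')%type) [set 0] (S `*` S') (d' + d).
Proof.
move=> hS hS' dS dS'.
have hX : subspace_set (S `*` S').
  split; first by split; [case: hS|case: hS'].
  by move=> c [x x'] [y y'] [/= ? ?] [/= ? ?]; split; [case: hS => _ h|case: hS' => _ h]; exact: h.
have S0 : S 0 by case: hS.
have S'0 : S' 0 by case: hS'.
apply: (rank_nullity linear_fst hX (@subspace_set1 _ _)); last first.
  suff -> : [set x.1 | x in S `*` S'] = S by [].
  apply/seteqP; split=> [_ [x [Sx _] <-]//|x Sx].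
  by exists (x, 0).
rewrite -[d']add0n.
apply: (rank_nullity linear_snd _ (@subspace_set1 _ _)).
- apply: subspace_setI => //; apply: subspace_preimage; first exact: linear_fst.
  exact: subspace_set1.
- suff -> : S `*` S' `&` fst @^-1` [set 0] `&` snd @^-1` [set 0] = [set 0] by exact: dim_set0.
  by apply/seteqP; split=> [[x x'] [[_ /= ->] ->]|_ ->].
- suff -> : [set x.2 | x in S `*` S' `&` fst @^-1` [set 0]] = S' by [].
  apply/seteqP; split=> [_ [x [[_ Sx] _] <-]//|x Sx].
  by exists (0, x).
Qed.

End DirectSum.

(** Addition maps the product of [A] and [B] onto [S] with trivial kernel. *)
Lemma dim_direct_sum (F : fieldType) (T : lmodType F) (S A B : set T) d dA dB :
    subspace_set A -> subspace_set B ->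
    (forall x, S x <-> exists a b, [/\ A a, B b & x = a + b]) ->
    (forall x, A x -> B x -> x = 0) ->
    has_dim_mod (@GRing.scale F T) [set 0] S d ->
    has_dim_mod (@GRing.scale F T) [set 0] A dA ->
    has_dim_mod (@GRing.scale F T) [set 0] B dB ->
  d = (dA + dB)%N.
Proof.
move=> hA hB SE AB0 dS hdA hdB.
have dX := dim_setX hA hB hdA hdB.
have hX : subspace_set (A `*` B).
  split; first by split; [case: hA|case: hB].
  by move=> c [x x'] [y y'] [/= ? ?] [/= ? ?]; split; [case: hA => _ h|case: hB => _ h]; exact: h.
pose add (x : T * T) := x.1 + x.2.
have addL c x y : add (c *: x + y) = c *: add x + add y.
  by case: x y => x x' [y y']; rewrite /add/= scalerDr addrACA.
rewrite addnC; apply: (dim_mod_uniq _ dX); rewrite -[d]add0n.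
apply: (rank_nullity addL hX (@subspace_set1 _ _)).
- suff -> : A `*` B `&` add @^-1` [set 0] = [set 0] by exact: dim_set0.
  apply/seteqP; split=> [[x y] [[/= Ax By] /eqP]|_ ->]; last first.
    by split; [split; [case: hA|case: hB]|rewrite /preimage /add/= addr0].
  rewrite /add/= addr_eq0 => /eqP xy.
  have y0 : y = 0.
    by apply: AB0 => //; rewrite -[y]opprK -xy -scaleN1r; exact: subspace_setZ.
  by rewrite xy y0 oppr0.
- suff -> : add @` (A `*` B) = S by [].
  apply/seteqP; split=> [_ [[x y] [/= Ax By] <-]|x /SE[y [z [Ay Bz ->]]]].
    by apply/SE; exists x, y.
  by exists (y, z).
Qed.

(** * Orthogonal projection onto a finite span *)

Section Orthogonal.
Variables (C : numClosedFieldType) (T : lmodType C) (ip : T -> T -> C).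
Hypothesis ipL : forall c x y z, ip (c *: x + y) z = c * ip x z + ip y z.
Hypothesis ipC : forall x y, ip x y = (ip y x)^*.
Hypothesis ip_eq0 : forall x, ip x x = 0 -> x = 0.

Lemma ip0l y : ip 0 y = 0.
Proof.
have := ipL 1 0 0 y; rewrite scale1r addr0 mul1r => /eqP.
by rewrite -subr_eq subrr => /eqP.
Qed.

Lemma ipDr x y z : ip x (y + z) = ip x y + ip x z.
Proof. by rewrite ipC -[y]scale1r ipL mul1r rmorphD/= -!ipC scale1r. Qed.

Lemma ipBl x y z : ip (x - y) z = ip x z - ip y z.
Proof. by rewrite addrC -scaleN1r ipL mulN1r addrC. Qed.

(** Gram-Schmidt, one vector at a time: [e'] is [e] minus its projection onto the span of [s], and
    the projection of [x] is corrected by its component along [e']. *)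
Lemma orthogonal_projection s x :
  exists2 y, Defs.span (@GRing.scale C T) s y &
    forall z, Defs.span (@GRing.scale C T) s z -> ip (x - y) z = 0.
Proof.
elim/last_ind: s x => [|s e IH] x.
  exists 0; first by exists (fun=> 0); rewrite /lincomb big_ord0.
  by move=> _ [c ->]; rewrite /lincomb big_ord0 ipC ip0l conjC0.
have sub z : Defs.span (@GRing.scale C T) s z -> Defs.span (@GRing.scale C T) (rcons s e) z.
  move=> [c ->]; exists (fun i => if (i < size s)%N then c i else 0).
  rewrite lincomb_rcons ltnn scale0r addr0; apply: eq_lincomb => i -> //.
have eE : Defs.span (@GRing.scale C T) (rcons s e) e.
  have := @mem_span _ _ (rcons s e) (size s).
  by rewrite size_rcons ltnSn nth_rcons ltnn eqxx; exact.
have hR := subspace_span (rcons s e).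
have [y ys yo] := IH x; have [g gs go] := IH e.
pose e' := e - g.
have e'R : Defs.span (@GRing.scale C T) (rcons s e) e' by apply: subspace_setB => //; exact: sub.
pose a := ip (x - y) e' / ip e' e'.
have ha : ip (x - y) e' = a * ip e' e'.
  (* If [e] already lies in the span of [s], then [e'] is [0] by definiteness and both sides vanish,
     whatever [a] is. *)
  case: (eqVneq (ip e' e') 0) => [e0|e0]; last by rewrite /a divfK.
  by rewrite (ip_eq0 e0) ipC ip0l conjC0 ip0l mulr0.
exists (y + a *: e').
  by apply: subspace_setD => //; [exact: sub|exact: subspace_setZ].
move=> _ [c ->]; rewrite lincomb_rcons.
set w := lincomb _ s c.
have ws : Defs.span (@GRing.scale C T) s w by exists c.
have -> : w + c (size s) *: e = c (size s) *: e' + (w + c (size s) *: g).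
  by rewrite /e' scalerBr [RHS]addrCA subrK.
have w's : Defs.span (@GRing.scale C T) s (w + c (size s) *: g).
  have hs := subspace_span s.
  by apply: subspace_setD => //; exact: subspace_setZ.
move: (w + _) w's => w' w's.
have De : x - (y + a *: e') = (- a) *: e' + (x - y).
  by rewrite opprD addrA addrC scaleNr.
have De0 : ip (x - (y + a *: e')) e' = 0 by rewrite De ipL ha mulNr addNr.
have Dw0 : ip (x - (y + a *: e')) w' = 0.
  by rewrite De ipL (yo _ w's) (go _ w's) mulr0 addr0.
by rewrite ipC ipL (ipC e') (ipC w') De0 Dw0 conjC0 mulr0 addr0 conjC0.
Qed.

End Orthogonal.

(** * The local structure of a polygon *)

Section Planar.
Variable R : realType.
Implicit Types (p q x : R * R) (e : R) (K : set (R * R)).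

Definition box p e q := `|p.1 - q.1| < e /\ `|p.2 - q.2| < e.

Lemma boxP p (A : set (R * R)) : nbhs p A <-> exists2 e, 0 < e & box p e `<=` A.
Proof.
split=> [/nbhs_ballP[e /= e0 eA]|[e e0 eA]]; first by exists e => // q [? ?]; apply: eA.
by apply/nbhs_ballP; exists e => //= q [? ?]; apply: eA.
Qed.

Lemma box_center p e : 0 < e -> box p e p.
Proof. by split; rewrite subrr normr0. Qed.

Definition lerp p q (t : R) := (p.1 + t * (q.1 - p.1), p.2 + t * (q.2 - p.2)).

Lemma lerp_gt0 (t x y : R) : 0 <= t <= 1 -> 0 < x -> 0 < y -> 0 < x + t * (y - x).
Proof.
move=> /andP[t0 t1] x0 y0; have [->|tn0] := eqVneq t 0; first by rewrite mul0r addr0.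
have tp : 0 < t by rewrite lt_neqAle eq_sym tn0.
have : 0 < t * y by rewrite mulr_gt0.
have : 0 <= (1 - t) * x by rewrite mulr_ge0 ?subr_ge0// ltW.
lra.
Qed.

Lemma lerp_abs_lt (t c x y e : R) : 0 <= t <= 1 -> `|c - x| < e -> `|c - y| < e ->
  `|c - (x + t * (y - x))| < e.
Proof.
move=> t01; rewrite !ltr_norml => /andP[x1 x2] /andP[y1 y2].
have h1 : 0 < (c - x) + e by lra.
have h2 : 0 < (c - y) + e by lra.
have h3 : 0 < e - (c - x) by lra.
have h4 : 0 < e - (c - y) by lra.
have := lerp_gt0 t01 h1 h2; have := lerp_gt0 t01 h3 h4; lra.
Qed.

Lemma box_lerp p e q q' t : 0 <= t <= 1 -> box p e q -> box p e q' ->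
  box p e (lerp q q' t).
Proof. by move=> t01 [? ?] [? ?]; split; exact: lerp_abs_lt. Qed.

Lemma continuous_lerp p q : continuous (lerp p q).
Proof.
have h (b c : R) : continuous (fun t : R => b + t * c).
  move=> t; apply: cvgD; [exact: cvg_cst|apply: cvgM; [exact: cvg_id|exact: cvg_cst]].
by move=> t; exact: (cvg_pair (h p.1 (q.1 - p.1) t) (h p.2 (q.2 - p.2) t)).
Qed.

(** Along a segment that misses the boundary, [K] and its closure have the same trace. This trace is
    open and closed, hence the whole segment. *)
Lemma lerp_avoid_boundary K p q : open K ->
    (forall t, 0 <= t <= 1 -> ~ (closure K `\` K) (lerp p q t)) -> K p -> K q.
Proof.
move=> oK avoid Kp.
have cK : closed (lerp p q @^-1` closure K).
  by apply: (closed_comp (fun t _ => @continuous_lerp p q t)); exact: closed_closure.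
have okK : open (lerp p q @^-1` K).
  by apply: open_comp => // t _; exact: continuous_lerp.
have : (`[0, 1] : set R) `&` lerp p q @^-1` K = `[0, 1]%classic.
  apply: segment_connected.
  - exists 0; split; first by rewrite /= in_itv/= lexx ler01.
    by rewrite /preimage /lerp/= !mul0r !addr0 -surjective_pairing.
  - by exists (lerp p q @^-1` K).
  - exists (lerp p q @^-1` closure K) => //.
    apply/seteqP; split=> t [t01 Kt]; split=> //; first exact: subset_closure.
    apply: contrapT => nKt; apply: (avoid t) => //.
move=> /seteqP[_ /(_ 1)]; case; first by rewrite /= in_itv/= lexx ler01.
by move=> _; rewrite /preimage /lerp/= !mul1r ![_ + (_ - _)]addrC !subrK -surjective_pairing.
Qed.

(** Measurability refers to the product sigma-algebra, so the open set is written as a countable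
    union of boxes with rational corners. *)
Lemma open_measurable_prod K : open K -> measurable K.
Proof.
move=> oK.
pose Q (u : rat * rat * rat * rat) : set (R * R) :=
  `]ratr u.1.1.1, ratr u.1.1.2[ `*` `]ratr u.1.2, ratr u.2[.
suff -> : K = \bigcup_(u in [set u | Q u `<=` K]) Q u.
  rewrite bigcup_mkcond; apply: countable_bigcupT_measurable => // u.
  case: ifPn => // _; exact: measurableX.
apply/seteqP; split=> [x Kx|x [u /= uK ux]]; last exact: uK.
have /boxP[e e0 eK] : nbhs x K by apply: open_nbhs_nbhs.
have h (z : R) : exists r s : rat, ratr r < z /\ z < ratr s /\ z - e < ratr r /\ ratr s < z + e.
  have [r] := @rat_in_itvoo R (z - e) z ltac:(lra); rewrite in_itv/= => /andP[r1 r2].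
  have [s] := @rat_in_itvoo R z (z + e) ltac:(lra); rewrite in_itv/= => /andP[s1 s2].
  by exists r, s.
have [r [s [r1 [s1 [r2 s2]]]]] := h x.1.
have [r' [s' [r1' [s1' [r2' s2']]]]] := h x.2.
exists (r, s, r', s') => /=; last by split; rewrite /= in_itv/=; apply/andP.
move=> y [/=]; rewrite !in_itv/= => /andP[y1 y2] /andP[y3 y4]; apply: eK.
by split; rewrite ltr_norml; apply/andP; split; lra.
Qed.

End Planar.

Section LocalPolygon.
Variables (R : realType) (m : nat).

Definition dotp (u v : R * R) := u.1 * v.1 + u.2 * v.2.
Definition edge (a : 'I_m -> R * R) j : R * R :=
  ((a (ordS j)).1 - (a j).1, (a (ordS j)).2 - (a j).2).

(* The part of [is_polygon] and [unit_outward_normal] used for the divergence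
   theorem, in a form invariant under exchanging the two coordinates. *)
Record local_polygon (a n : 'I_m -> R * R) (K : set (R * R)) : Prop := LocalPolygon {
  lp_bounded : exists2 r, 0 < r & forall x, K x -> `|x.1| < r /\ `|x.2| < r ;
  lp_measurable : measurable K ;
  lp_away : forall p, (forall j, ~ seg a j p) ->
    exists2 e, 0 < e & forall q, box p e q -> (K q <-> K p) ;
  lp_edge : forall j t, 0 < t < 1 -> exists2 e, 0 < e &
    forall q, box (ept a j t) e q ->
      (dotp (q.1 - (ept a j t).1, q.2 - (ept a j t).2) (n j) < 0 -> K q) /\
      (0 < dotp (q.1 - (ept a j t).1, q.2 - (ept a j t).2) (n j) -> ~ K q) ;
  lp_disjoint : forall j k x, j <> k -> seg a j x -> seg a k x -> x = a j \/ x = a k ;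
  lp_unit : forall j, (n j).1 ^+ 2 + (n j).2 ^+ 2 = 1 ;
  lp_orth : forall j, dotp (n j) (edge a j) = 0 }.

Definition swapp (x : R * R) := (x.2, x.1).

Lemma seg_swap (a : 'I_m -> R * R) j x : seg (m:=m) (swapp \o a) j x <-> seg a j (swapp x).
Proof.
by split=> [[t t01]|[t t01]]; case: x => x1 x2 [e1 e2]; exists t => //; congr pair.
Qed.

Lemma local_polygon_swap a n K : local_polygon a n K ->
  local_polygon (fun j => swapp (a j)) (fun j => swapp (n j)) (swapp @^-1` K).
Proof.
case=> [[r r0 Kr] mK away edg dis unt orth]; split.
- by exists r => // x /Kr[]; split.
- rewrite -[X in measurable X]setTI.
  exact: (measurable_fun_pair measurable_snd measurable_fst measurableT mK).
- move=> p pa; have [|e e0 he] := away (swapp p).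
    by move=> j /seg_swap; exact: pa.
  by exists e => // q [h1 h2]; apply: he; split.
- move=> j t /(edg j)[e e0 he]; exists e => // q [h1 h2].
  have [|g1 g2] := he (swapp q); first by split.
  by split; rewrite /dotp /= addrC; [exact: g1|exact: g2].
- move=> j k x jk /seg_swap xj /seg_swap xk.
  have [e|e] := dis j k (swapp x) jk xj xk; [left|right]; rewrite /= -e; by case: (x).
- by move=> j; rewrite /= addrC.
- by move=> j; rewrite -(orth j) /dotp /= addrC.
Qed.

Section OfPolygon.
Variables (a n : 'I_m -> R * R) (K : set (R * R)).
Hypotheses (polyK : is_polygon a K) (nK : unit_outward_normal a K n).

Let oK : open K. Proof. by case: polyK => _ _ _ []. Qed.
Let bK : closure K `\` K = \bigcup_j seg a j. Proof. by case: polyK => _ _ _ []. Qed.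

Lemma continuous_ept j : continuous (ept a j).
Proof. exact: continuous_lerp. Qed.

Lemma closed_seg j : closed (seg a j).
Proof.
apply: compact_closed; first exact: norm_hausdorff.
apply: continuous_compact; last exact: segment_compact.
by apply: continuous_subspaceT; exact: continuous_ept.
Qed.

(** The predicate [P] allows one edge to be left out, as is needed near an interior point of that
    edge. *)
Lemma near_avoid_seg (P : pred 'I_m) p : (forall j, P j -> ~ seg a j p) ->
  exists2 e, 0 < e & forall q, box p e q -> forall j, P j -> ~ seg a j q.
Proof.
move=> pP; suff : nbhs p [set q | forall j, P j -> ~ seg a j q] by move=> /boxP[e e0 he]; exists e.
have H j : nbhs p [set q | P j -> ~ seg a j q].
  have [Pj|/negbTE nPj] := boolP (P j); last first.
    by rewrite [X in nbhs p X](_ : _ = setT) ?nPj; [exact: filterT|exact/seteqP].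
  have : nbhs p (~` seg a j).
    apply: open_nbhs_nbhs; split; first exact/closed_openC/closed_seg.
    exact: pP.
  by apply: (@filterS _ (nbhs p) (nbhs_filter p)) => q hq _; exact: hq.
exact: (@filter_forall _ _ _ (nbhs p) _ H).
Qed.

Lemma box_avoid_iff p e q : (forall q j, box p e q -> ~ seg a j q) -> 0 < e ->
  box p e q -> (K q <-> K p).
Proof.
move=> av e0 pq; have pp := box_center p e0.
by split; apply: lerp_avoid_boundary => // t t01; rewrite bK => -[j _];
  apply: av; exact: box_lerp.
Qed.

Lemma dotp_lerp (p q q' v : R * R) t : dotp ((lerp q q' t).1 - p.1, (lerp q q' t).2 - p.2) v =
  dotp (q.1 - p.1, q.2 - p.2) v +
  t * (dotp (q'.1 - p.1, q'.2 - p.2) v - dotp (q.1 - p.1, q.2 - p.2) v).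
Proof. rewrite /dotp /lerp/=; ring. Qed.

Lemma dotp_seg j t x : seg a j x -> dotp (x.1 - (ept a j t).1, x.2 - (ept a j t).2) (n j) = 0.
Proof.
case=> s _ <-; have [_ no _] := nK j; rewrite /dotp /ept/=.
transitivity ((s - t) * ((n j).1 * ((a (ordS j)).1 - (a j).1) +
  (n j).2 * ((a (ordS j)).2 - (a j).2))); first by ring.
by rewrite no mulr0.
Qed.

(** Distinct edges meet only at a common vertex, and an interior point of edge [j] is neither of its
    end points. *)
Lemma ept_interior j k t : 0 < t < 1 -> j <> k -> ~ seg a k (ept a j t).
Proof.
move=> /andP[t0 t1] jk sk; case: polyK => _ hne hdis _.
have sj : seg a j (ept a j t) by exists t => //; rewrite /= in_itv/= !ltW.
have h0 : ept a j t <> a j.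
  rewrite /ept [a j in RHS]surjective_pairing => -[e1 e2].
  apply: (hne j); rewrite [LHS]surjective_pairing [RHS]surjective_pairing.
  have /eqP := e1; rewrite -subr_eq0 addrC addKr mulf_eq0 gt_eqF//= subr_eq0 => /eqP ->.
  by have /eqP := e2; rewrite -subr_eq0 addrC addKr mulf_eq0 gt_eqF//= subr_eq0 => /eqP ->.
have h1 : ept a j t <> a (ordS j).
  rewrite /ept [a (ordS j) in RHS]surjective_pairing => -[e1 e2].
  have t1' : 1 - t != 0 by rewrite subr_eq0 gt_eqF.
  have f (x y : R) : x + t * (y - x) = y -> x = y.
    move=> e; have : (1 - t) * (x - y) = x + t * (y - x) - y by ring.
    by rewrite e subrr => /eqP; rewrite mulf_eq0 (negbTE t1')/= subr_eq0 => /eqP.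
  by apply: (hne j); rewrite [LHS]surjective_pairing [RHS]surjective_pairing (f _ _ e1) (f _ _ e2).
have [[ek e]|[ej e]] := hdis j k _ jk sj sk; last exact: h0.
by apply: h1; rewrite e ek.
Qed.

(** The normal condition speaks only of points on the normal line. Any other nearby point on the
    same side of the edge is joined to one of these by a segment that stays on that side, inside a
    box that no other edge enters; it misses the boundary, so [lerp_avoid_boundary] applies. *)
Lemma local_polygon_of : local_polygon a n K.
Proof.
split.
- case: polyK => _ _ _ [_ _ [r hr] _]; exists (`|r| + 1); first by rewrite ltr_wpDl.
  move=> x /hr[h1 h2]; have := ler_norm r.
  by split; lra.
- exact: open_measurable_prod.
- move=> p pa; have [//|e e0 he] := @near_avoid_seg xpredT p _.
  exists e => // q; apply: box_avoid_iff => // q' j /he; exact.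
- move=> j t t01; have [_ no nout] := nK j.
  have [|e e0 he] := @near_avoid_seg (predC1 j) (ept a j t) _.
    by move=> k /eqP kj; apply: ept_interior => //; exact: nesym.
  have [e' e'0 hs] := nout t t01.
  exists e => // q pq.
  set p := ept a j t in pq he hs *.
  (* Small enough for the two points at distance [s] along the normal to lie both in the box free of
     other edges and in the range of the normal condition. *)
  pose s := Num.min e e' / 2.
  have s0 : 0 < s by rewrite divr_gt0// lt_min e0.
  have se : s < e.
    by rewrite /s ltr_pdivrMr// gt_min; apply/orP; left; lra.
  have se' : s < e'.
    by rewrite /s ltr_pdivrMr// gt_min; apply/orP; right; lra.
  have [nKs Ks] : ~ K (p.1 + s * (n j).1, p.2 + s * (n j).2) /\
     K (p.1 - s * (n j).1, p.2 - s * (n j).2) by apply: hs; rewrite s0.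
  have [n1 n2] : `|(n j).1| <= 1 /\ `|(n j).2| <= 1.
    have [un _ _] := nK j.
    have := sqr_ge0 (n j).1; have := sqr_ge0 (n j).2.
    by split; rewrite ler_norml; apply/andP; split; nra.
  have bs (c : R * R) : `|c.1| <= s -> `|c.2| <= s -> box p e (p.1 + c.1, p.2 + c.2).
    move=> c1 c2; split; rewrite /= opprD addrA subrr sub0r normrN; exact: le_lt_trans se.
  have sn (i : R) : `|i| <= 1 -> `|s * i| <= s.
    by move=> hi; rewrite normrM gtr0_norm// ler_piMr// ltW.
  have d0 : dotp (n j) (n j) = 1 by have [un _ _] := nK j; rewrite /dotp -!expr2.
  split=> dq.
  + apply: (lerp_avoid_boundary oK _ Ks) => t' t'01; rewrite bK => -[k _ sk].
    have bt : box p e (lerp (p.1 - s * (n j).1, p.2 - s * (n j).2) q t').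
      apply: box_lerp => //; rewrite -!mulrN.
      by apply: (bs (s * - (n j).1, s * - (n j).2)); apply: sn; rewrite normrN.
    have [kj|kj] := eqVneq k j; last exact: (he _ bt k kj).
    (* On edge [j] the normal coordinate is [0], whereas along this segment it is a convex
       combination of [- s] and of the negative normal coordinate of [q]. *)
    rewrite kj in sk; have := dotp_seg t sk; rewrite -/p dotp_lerp.
    set u := dotp _ _; have -> : u = - s.
      transitivity (- s * dotp (n j) (n j)); last by rewrite d0 mulr1.
      by rewrite /u /dotp/=; ring.
    set w := dotp _ _ in dq *.
    have := @lerp_gt0 _ t' s (- w) t'01 s0; rewrite oppr_gt0 => /(_ dq).
    lra.
  + move=> Kq; apply: nKs.
    apply: (lerp_avoid_boundary oK _ Kq) => t' t'01; rewrite bK => -[k _ sk].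
    have bt : box p e (lerp q (p.1 + s * (n j).1, p.2 + s * (n j).2) t').
      apply: box_lerp => //.
      by apply: (bs (s * (n j).1, s * (n j).2)); apply: sn.
    have [kj|kj] := eqVneq k j; last exact: (he _ bt k kj).
    rewrite kj in sk; have := dotp_seg t sk; rewrite -/p dotp_lerp.
    set w := dotp _ _ in dq *.
    set u := dotp (_ + _ - _, _) _; have -> : u = s.
      transitivity (s * dotp (n j) (n j)); last by rewrite d0 mulr1.
      by rewrite /u /dotp/=; ring.
    have := @lerp_gt0 _ t' w s t'01 dq s0.
    lra.
- move=> j k x jk xj xk; case: polyK => _ _ hdis _.
  by have [[]|[]] := hdis j k x jk xj xk; [right|left].
- by move=> j; have [] := nK j.
- by move=> j; have [] := nK j.
Qed.

End OfPolygon.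
End LocalPolygon.

(** * Horizontal sections *)

Section LocallyConstant.
Variables (R : realType) (D : R -> R) (P : set R) (r : R).
Hypothesis Dloc : forall x, exists e c, [/\ 0 < e,
  forall x', 0 < `|x - x'| < e -> D x' = c & ~ P x -> D x = c].
Hypothesis Dr : forall x, r < x -> D x = 0.

(** [D] may take arbitrary values on [P], so the connectedness argument concerns the set [A] of
    points with a punctured neighbourhood on which [D] vanishes. It is open and closed and contains
    every point far to the right. *)
Lemma locally_constant_eq0 x : ~ P x -> D x = 0.
Proof.
move=> Px; pose A := [set z : R | exists2 e, 0 < e & forall z', 0 < `|z - z'| < e -> D z' = 0].
(* A common point of two punctured neighbourhoods: of the candidates [w + d / 2] and [w + d / 3], at
   most one is equal to [z]. *)
have pick (z : R) e (w : R) e' : 0 < e -> 0 < e' -> `|z - w| < e ->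
    exists2 u, 0 < `|z - u| < e & 0 < `|w - u| < e'.
  move=> e0 e'0 zw.
  pose d := Num.min e' (e - `|z - w|); have d0 : 0 < d by rewrite lt_min e'0 subr_gt0.
  have de' : d <= e' by rewrite ge_min lexx.
  have de : d <= e - `|z - w| by rewrite ge_min lexx orbT.
  have h : forall u : R, u != z -> 0 < `|w - u| < d -> 0 < `|z - u| < e.
    move=> u uz /andP[_ wu]; rewrite normr_gt0 subr_eq0 eq_sym uz/=.
    have := ler_normD (z - w) (w - u); rewrite addrA subrK; lra.
  have [u0|u0] := eqVneq (w + d / 2) z.
    have : 0 < `|w - (w + d / 3)| < d.
      rewrite opprD addrA subrr sub0r normrN gtr0_norm; last by rewrite divr_gt0.
      by apply/andP; split; lra.
    move=> hw; exists (w + d / 3); last by have /andP[-> ?] := hw; lra.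
    apply: h => //; apply/eqP; lra.
  have : 0 < `|w - (w + d / 2)| < d.
    rewrite opprD addrA subrr sub0r normrN gtr0_norm; last by rewrite divr_gt0.
    by apply/andP; split; lra.
  move=> hw; exists (w + d / 2); last by have /andP[-> ?] := hw; lra.
  exact: h.
have Aloc z e c : 0 < e -> (forall z', 0 < `|z - z'| < e -> D z' = c) ->
    forall w, `|z - w| < e -> A w -> c = 0.
  move=> e0 hz w zw [e' e'0 hw]; have [u zu wu] := pick z e w e' e0 e'0 zw.
  by rewrite -(hz u zu) hw.
have oA : open A.
  rewrite openE => z [e e0 hz]; apply/nbhs_ballP; exists e => //= w.
  rewrite /ball/= => zw.
  have [e' [c [e'0 hw _]]] := Dloc w.
  have [u zu wu] := pick z e w e' e0 e'0 zw.
  by exists e' => // v /hw ->; rewrite -(hw u wu) hz.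
have cA : closed A.
  move=> z clz; have [e [c [e0 hz _]]] := Dloc z.
  have [w [Aw zw]] := clz (ball z e) (nbhsx_ballx z e e0).
  by exists e => // z' /hz ->; exact: (Aloc _ _ _ e0 hz w).
(* The margin [2] keeps the neighbourhood of radius [1] of [M] to the right of [r]. *)
pose M := Num.max x r + 2.
have xM : x <= M.
  have : x <= Num.max x r by rewrite le_max lexx.
  rewrite /M; lra.
have : (`[x, M] : set R) `&` A = `[x, M]%classic.
  apply: segment_connected; [|by exists A..].
  exists M; split; first by rewrite /= in_itv/= xM lexx.
  exists 1 => // z' /andP[_]; rewrite ltr_distl => /andP[h1 h2]; apply: Dr.
  have : r <= Num.max x r by rewrite le_max lexx orbT.
  move: h1 h2; rewrite /M; lra.
move=> /seteqP[_ /(_ x)]; case; first by rewrite /= in_itv/= lexx.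
move=> _ Ax; have [e [c [e0 hz ->//]]] := Dloc x.
by apply: (Aloc _ _ _ e0 hz x) => //; rewrite subrr normr0.
Qed.

End LocallyConstant.

Section Sections.
Variables (R : realType) (m : nat) (a n : 'I_m -> R * R) (K : set (R * R)).
Hypothesis lpK : local_polygon a n K.

(** The inequalities are strict because heights of vertices are excluded; a horizontal edge is never
    crossed. *)
Definition crossing j (y : R) :=
  ((a j).2 < y < (a (ordS j)).2) || ((a (ordS j)).2 < y < (a j).2).

Definition crosspt j (y : R) := (a j).1 + (y - (a j).2) / (edge a j).2 * (edge a j).1.

Section Generic.
Variable y : R.
Hypothesis hy : forall j, y != (a j).2.

Lemma crossing_param j : crossing j y ->
  0 < (y - (a j).2) / (edge a j).2 < 1 /\ (crosspt j y, y) = ept a j ((y - (a j).2) / (edge a j).2).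
Proof.
rewrite /crossing /crosspt /ept/= => h; set d := (edge a j).2.
have d0 : d != 0.
  by apply: contraTneq h => /eqP; rewrite /d/= subr_eq0 => /eqP ->; rewrite !lt_asym.
split; last by rewrite -[(a (ordS j)).2 - _]/d divfK// [_ + (y - _)]addrC subrK.
case/orP: h => /andP[h1 h2].
  have dp : 0 < d by rewrite /d/= subr_gt0; exact: lt_trans h2.
  apply/andP; split; first by apply: divr_gt0 => //; rewrite subr_gt0.
  by rewrite ltr_pdivrMr// mul1r /d/= ltrD2r.
have dn : d < 0 by rewrite /d/= subr_lt0; exact: lt_trans h2.
rewrite -mulrNN -invrN; apply/andP; split.
  by apply: divr_gt0; rewrite oppr_gt0// subr_lt0.
by rewrite ltr_pdivrMr ?oppr_gt0// mul1r /d/= ltrN2 ltrD2r.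
Qed.

Lemma crossing_seg j : crossing j y -> seg a j (crosspt j y, y).
Proof.
move=> /crossing_param[/andP[t0 t1] ->]; eexists; last reflexivity.
by rewrite /= in_itv/= !ltW.
Qed.

Lemma seg_crossing j x : seg a j (x, y) -> crossing j y /\ x = crosspt j y.
Proof.
move=> [t]; rewrite /= in_itv/= => /andP[t0 t1] [xE yE].
have d0 : (edge a j).2 != 0.
  apply: contraNneq (hy j) => d0; rewrite -yE.
  by move: d0; rewrite /edge/= => ->; rewrite mulr0 addr0.
have tE : (y - (a j).2) / (edge a j).2 = t by rewrite -yE addrC addKr mulfK.
split; last by rewrite /crosspt tE -xE.
have t0' : 0 < t.
  rewrite lt_neqAle t0 andbT; apply: contraNneq (hy j) => e.
  by rewrite -yE -e mul0r addr0.
have t1' : t < 1.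
  rewrite lt_neqAle t1 andbT; apply: contraNneq (hy (ordS j)) => e.
  by rewrite -yE e mul1r addrC subrK.
rewrite /crossing -yE; move: d0; rewrite /edge/=; set d := _ - _ => d0.
have -> : (a (ordS j)).2 = (a j).2 + d by rewrite /d addrC subrK.
have [dp|dn|/eqP] := ltgtP 0 d; last by rewrite eq_sym (negbTE d0).
- apply/orP; left; apply/andP; split; nra.
- apply/orP; right; apply/andP; split; nra.
Qed.

(** Two edges meet only at a vertex, and no vertex lies at height [y]. *)
Lemma crosspt_inj j k : crossing j y -> crossing k y -> j <> k -> crosspt j y <> crosspt k y.
Proof.
move=> cj ck jk e; have := crossing_seg cj; have := crossing_seg ck; rewrite -e => sk sj.
have [/(congr1 snd)/=|/(congr1 snd)/=] := lp_disjoint lpK jk sj sk.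
  by apply/eqP; exact: hy.
by apply/eqP; exact: hy.
Qed.

(** A vertical unit normal would make the edge horizontal. *)
Lemma normal_x_neq0 j : crossing j y -> (n j).1 != 0.
Proof.
move=> cj; apply/eqP => n0; have := lp_unit lpK j; have := lp_orth lpK j.
rewrite /dotp n0 mul0r add0r => /eqP; rewrite mulf_eq0 => /orP[/eqP->|].
  by rewrite expr0n addr0 => /eqP; rewrite eq_sym oner_eq0.
rewrite /edge/= subr_eq0 => /eqP e; move: cj; rewrite /crossing e.
by rewrite !lt_asym.
Qed.

(** At the crossing point of edge [k], [lp_edge] puts [K] on the side opposite to the normal, so the
    indicator has the same jump there as the term of [k]. No other term jumps, by [crosspt_inj].
    Elsewhere [lp_away] applies. *)
Lemma section_locally_constant (x : R) :
  let D x := \1_K (x, y) - \sum_(j | crossing j y) Num.sg (n j).1 * (x < crosspt j y)%R%:R : R in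
  exists e c, [/\ 0 < e, forall x', 0 < `|x - x'| < e -> D x' = c &
    ~ (exists2 j, crossing j y & x = crosspt j y) -> D x = c].
Proof.
move=> D.
have [e0 e00 he0] : exists2 e, 0 < e & forall x', `|x - x'| < e ->
    forall j, x != crosspt j y -> (x' < crosspt j y) = (x < crosspt j y).
  have H j : nbhs x [set x' | x != crosspt j y -> (x' < crosspt j y) = (x < crosspt j y)].
    have [e|xj] := eqVneq x (crosspt j y).
      rewrite [X in nbhs x X](_ : _ = setT); first exact: filterT.
      exact/seteqP.
    apply/nbhs_ballP; exists `|x - crosspt j y|.
      by rewrite /= normr_gt0 subr_eq0.
    move=> x'; rewrite /ball/= => hx' _.
    have [h|h|h] := ltgtP x (crosspt j y).
    - move: hx'; rewrite (@ltr0_norm _ (x - crosspt j y)) ?subr_lt0// ltr_distl => /andP[]; lra.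
    - move: hx'; rewrite (@gtr0_norm _ (x - crosspt j y)) ?subr_gt0// ltr_distl.
      move=> /andP[h1 h2].
      by apply/negbTE; rewrite -leNgt; lra.
    - by rewrite h eqxx in xj.
  have : nbhs x [set x' | forall j, x != crosspt j y -> (x' < crosspt j y) = (x < crosspt j y)].
    exact: (@filter_forall _ _ _ (nbhs x) _ H).
  move=> /nbhs_ballP[e /= e0 he].
  by exists e.
have [[k ck xk]|xN] := pselect (exists2 j, crossing j y & x = crosspt j y).
- have [t01 ptE] := crossing_param ck.
  have [e1 e10 he1] := lp_edge lpK k t01; rewrite -ptE -xk in he1.
  have nk := normal_x_neq0 ck.
  pose rest := \sum_(j | crossing j y && (j != k)) Num.sg (n j).1 * (x < crosspt j y)%R%:R.
  (* If [(n k).1] is positive, the indicator minus the term of [k] is [1 - 1] on the left and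
     [0 - 0] on the right; if it is negative, [0 + 1] on the left and [1 - 0] on the right. *)
  exists (Num.min e0 e1), (((n k).1 < 0)%R%:R - rest); split; first by rewrite lt_min e00.
    move=> x' /andP[x'0]; rewrite lt_min => /andP[x'e0 x'e1].
    have -> : D x' = \1_K (x', y) - Num.sg (n k).1 * (x' < x)%R%:R - rest.
      rewrite /D (bigD1 k)//= -xk opprD addrA; congr (_ - _).
      apply: eq_bigr => j /andP[cj jk]; rewrite (he0 x' x'e0)//.
      by rewrite xk; apply/eqP/crosspt_inj => //; apply/nesym/eqP.
    have [|out inn] := he1 (x', y); first by split=> //=; rewrite subrr normr0.
    move: out inn; rewrite /dotp/= subrr mul0r addr0 indicE => inn out.
    have xx' : x' != x by rewrite eq_sym -subr_eq0 -normr_gt0.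
    congr (_ - _); have [n0|n0|n0] := ltgtP 0 (n k).1; last by rewrite n0 eqxx in nk.
      rewrite gtr0_sg//; have [xx|xx|xx] := ltgtP x' x; last by rewrite xx eqxx in xx'.
        rewrite mem_set; first by rewrite mul1r subrr.
        by apply: inn; rewrite pmulr_llt0// subr_lt0.
      rewrite memNset; first by rewrite mulr0 subr0.
      by apply: out; rewrite pmulr_lgt0// subr_gt0.
    rewrite ltr0_sg//; have [xx|xx|xx] := ltgtP x' x; last by rewrite xx eqxx in xx'.
      rewrite memNset; first by rewrite mulN1r opprK add0r.
      by apply: out; rewrite nmulr_lgt0// subr_lt0.
    rewrite mem_set; first by rewrite mulr0 subr0.
    by apply: inn; rewrite nmulr_llt0// subr_gt0.
  by move=> xN; exfalso; apply: xN; exists k.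
- have [|e1 e10 he1] := lp_away lpK (p := (x, y)).
    by move=> j /seg_crossing[cj xj]; apply: xN; exists j.
  exists (Num.min e0 e1), (D x); split=> //; first by rewrite lt_min e00.
  move=> x' /andP[x'0]; rewrite lt_min => /andP[x'e0 x'e1]; congr (_ - _).
    rewrite !indicE; congr (_%:R); congr nat_of_bool; apply/idP/idP; rewrite !inE.
      by move/(he1 (x', y)); apply; split=> //=; rewrite subrr normr0.
    by move=> Kx; apply/(he1 (x', y)) => //; split=> //=; rewrite subrr normr0.
  apply: eq_bigr => j cj; rewrite (he0 x' x'e0)//.
  by apply/eqP => xj; apply: xN; exists j.
Qed.

Lemma section_indicator (x : R) : (forall j, crossing j y -> x <> crosspt j y) ->
  \1_K (x, y) = \sum_(j | crossing j y) Num.sg (n j).1 * (x < crosspt j y)%R%:R :> R.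
Proof.
move=> hx; apply/eqP; rewrite -subr_eq0; apply/eqP.
have [r r0 Kr] := lp_bounded lpK.
pose M := r + \sum_j `|crosspt j y|.
have hM j : crosspt j y <= M.
  rewrite (le_trans (ler_norm _))// /M (bigD1 j)//= addrCA lerDl.
  by rewrite addr_ge0// ?sumr_ge0// ltW.
apply: (locally_constant_eq0 (section_locally_constant) (r := M)).
  move=> z Mz; rewrite indicE memNset; last first.
    move/Kr => [/=]; rewrite ltr_norml => /andP[_ zr] _.
    have : 0 <= \sum_j `|crosspt j y| by exact: sumr_ge0.
    move: Mz; rewrite /M; lra.
  rewrite big1 ?subr0// => j _; rewrite ltNge.
  by rewrite (le_trans (hM j) (ltW Mz)) mulr0.
by case=> j cj xj; exact: (hx j cj).
Qed.

End Generic.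
End Sections.

(** * The divergence theorem for monomials *)

(** Characteristic zero is stated so as to cover [{poly C}] as coefficient ring too, for polynomials
    in two variables. *)
Lemma deriv_eq0_polyC (F : idomainType) (p : {poly F}) :
  (forall i, i.+1%:R != 0 :> F) -> p^`() = 0 -> p = (p`_0)%:P.
Proof.
move=> F0 dp; apply/polyP => -[|i]; rewrite coefC//=.
have /polyP/(_ i) := dp; rewrite coef_deriv coef0 => /eqP.
by rewrite -[X in X == _]mulr_natr mulf_eq0 (negbTE (F0 i)) orbF => /eqP.
Qed.

Section Primitive.
Variable F : numFieldType.
Implicit Types p q : {poly F}.

Definition prim q : {poly F} := \poly_(i < (size q).+1) (q`_i.-1 / i%:R).

(* For [i = 0] the right-hand side is [0], by division by zero. *)
Lemma coef_prim q i : (prim q)`_i = q`_i.-1 / i%:R.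
Proof.
rewrite coef_poly; case: ltnP => // hi; rewrite nth_default ?mul0r//.
by case: i hi.
Qed.

Lemma deriv_prim q : (prim q)^`() = q.
Proof.
by apply/polyP => i; rewrite coef_deriv coef_prim/= -[LHS]mulr_natr divfK//.
Qed.

Lemma prim_is_linear c p q : prim (c *: p + q) = c *: prim p + prim q.
Proof.
by apply/polyP => i; rewrite !(coef_prim, coefD, coefZ) mulrDl mulrA.
Qed.

(* The integral of [q] over [0, 1]. *)
Definition pint q : F := (prim q).[1].

Lemma pint_linear c p q : pint (c *: p + q) = c * pint p + pint q.
Proof. by rewrite /pint prim_is_linear hornerD hornerZ. Qed.

Lemma prim0 q : (prim q).[0] = 0.
Proof. by rewrite horner_coef0 coef_prim invr0 mulr0. Qed.

(** The primitive of the derivative of [q] differs from [q] by a constant. *)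
Lemma pint_deriv q : pint q^`() = q.[1] - q.[0].
Proof.
have : (prim q^`() - q)^`() = 0 by rewrite derivB deriv_prim subrr.
have F0 (i : nat) : i.+1%:R != 0 :> F by rewrite pnatr_eq0.
move/(deriv_eq0_polyC F0) => e.
have h x : (prim q^`() - q).[x] = (prim q^`() - q)`_0 by rewrite {1}e hornerC.
have := h 1; rewrite -(h 0) !hornerE prim0 sub0r /pint => e0.
by rewrite -e0 [RHS]addrC subrK.
Qed.

End Primitive.

Section RealIntegrals.
Variable R : realType.
Implicit Types p q : {poly R}.
Local Notation mu := (@lebesgue_measure R).

Lemma integral_deriv_poly p (a b : R) : a <= b ->
  (\int[mu]_(x in `[a, b]) (p^`().[x])%:E = (p.[b] - p.[a])%:E)%E.
Proof.
rewrite le_eqVlt => /predU1P[<-|ab]; first by rewrite set_itv1 integral_set1 subrr.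
rewrite (continuous_FTC2 (F := horner p) ab)//.
- by apply: continuous_subspaceT => x; exact: continuous_horner.
- split.
  + by move=> x _; exact: derivable_horner.
  + by apply: cvg_at_right_filter; exact: continuous_horner.
  + by apply: cvg_at_left_filter; exact: continuous_horner.
- by move=> x _; rewrite derive1E; have [_ ->] := is_derive_poly p x.
Qed.

Lemma measurable_horner p (D : set R) : measurable_fun D (horner p).
Proof.
apply: measurable_funTS; apply: continuous_measurable_fun.
exact: continuous_horner.
Qed.

Lemma integrable_horner p (a b : R) : mu.-integrable `[a, b] (EFin \o horner p).
Proof.
apply: continuous_compact_integrable; first exact: segment_compact.
by apply: continuous_subspaceT => x; exact: continuous_horner.
Qed.

(** The finite list [s] collects the points where the formula for [f] may fail, such as crossing
    points and heights of vertices. Writing the integrands as derivatives turns each term into a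
    difference of end values. *)
Lemma integral_piecewise_poly (I : finType) (f : R -> \bar R) (s : seq R)
    (Q : I -> {poly R}) (lo hi : I -> R) :
    measurable_fun setT f -> (forall i, lo i <= hi i) ->
    (forall x, x \notin s -> f x = (\sum_i (lo i <= x <= hi i)%R%:R * (Q i)^`().[x])%:E) ->
  (\int[mu]_x f x = (\sum_i ((Q i).[hi i] - (Q i).[lo i]))%:E)%E.
Proof.
move=> mf lohi fE.
pose g i := (EFin \o horner (Q i)^`()) \_ `[lo i, hi i].
have ig i : mu.-integrable setT (g i).
  have ih := integrable_horner (Q i)^`() (lo i) (hi i).
  exact: ((integrable_mkcond (mu := mu) _ (measurable_itv `[lo i, hi i])).1 ih).
have gE x : (\sum_i g i x = (\sum_i (lo i <= x <= hi i)%R%:R * (Q i)^`().[x])%:E)%E.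
  rewrite -sumEFin; apply: eq_bigr => i _.
  rewrite /g patchE mem_setE in_itv/=; case: (_ && _); first by rewrite mul1r.
  by rewrite mul0r.
rewrite (ae_eq_integral (mu := mu) (fun x => \sum_i g i x)%E)//.
- rewrite integral_sum// -sumEFin; apply: eq_bigr => i _.
  by rewrite -integral_mkcond integral_deriv_poly.
- by apply: emeasurable_sum => i; have /integrableP[] := ig i.
- have cs : countable [set` s] by apply: finite_set_countable; exact: finite_seq.
  exists [set` s]; split.
  + by apply: countable_measurable => // t; exact: measurable_set1.
  + exact: countable_lebesgue_measure0.
  + move=> x /= hx; apply: contrapT => /negP xs; apply: hx => _.
    by rewrite gE fE.
Qed.

End RealIntegrals.

Section Green.
Variables (R : realType) (m : nat) (a n : 'I_m -> R * R) (K : set (R * R)).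
Hypothesis lpK : local_polygon a n K.
Local Notation mu := (@lebesgue_measure R).
Local Notation mu2 := ((@lebesgue_measure R) \x (@lebesgue_measure R))%E.

Definition edge_len j := Num.sqrt ((edge a j).1 ^+ 2 + (edge a j).2 ^+ 2).
Definition edge_x j : {poly R} := (a j).1%:P + 'X * (edge a j).1%:P.
Definition edge_y j : {poly R} := (a j).2%:P + 'X * (edge a j).2%:P.

Lemma edge_xE j t : (edge_x j).[t] = (ept a j t).1.
Proof. by rewrite /edge_x !hornerE. Qed.

Lemma edge_yE j t : (edge_y j).[t] = (ept a j t).2.
Proof. by rewrite /edge_y !hornerE. Qed.

(** Up to sign, the normal is the edge direction turned by a right angle. The sign depends on the
    unknown orientation, so the squares are compared. *)
Lemma normal_edge_len j : edge_len j * (n j).1 = Num.sg (n j).1 * `|(edge a j).2|.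
Proof.
rewrite {1}(numEsg (n j).1) mulrCA; congr (_ * _).
apply/eqP; rewrite -(@eqrXn2 _ 2)// ?mulr_ge0// ?sqrtr_ge0//.
rewrite exprMn sqr_sqrtr ?addr_ge0 ?sqr_ge0// !real_normK ?num_real//.
have := lp_orth lpK j; have := lp_unit lpK j; rewrite /dotp => h1 h2; apply/eqP.
have h : (n j).1 * (edge a j).1 = - ((n j).2 * (edge a j).2).
  by apply/eqP; rewrite -subr_eq0 opprK h2.
rewrite mulrDl -!exprMn mulrC h sqrrN !exprMn ![_ * (edge a j).2 ^+ 2]mulrC.
by rewrite -mulrDr addrC h1 mulr1.
Qed.

Section Monomial.
Variables (p : {poly R}) (k : nat).

(** The factor in the first variable is a derivative, so that its primitive [p] is at hand. *)
Let h (z : R * R) : R := p^`().[z.1] * z.2 ^+ k.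

Lemma polygon_finite_measure : (mu2 K < +oo)%E.
Proof.
have [r r0 Kr] := lp_bounded lpK.
pose I : set R := `]- r, r[%classic.
have e : mu2 (I `*` I) = (mu I * mu I)%E.
  exact: (product_measure1E mu mu (measurable_itv `]- r, r[) (measurable_itv `]- r, r[)).
have Ifin : (mu2 (I `*` I) < +oo)%E.
  rewrite e; have -> : mu I = (r - - r)%:E.
    by rewrite lebesgue_measure_itv/= lte_fin gtrN// -EFinD.
  by rewrite -EFinM ltry.
apply: le_lt_trans Ifin; apply: le_measure.
- by rewrite inE; exact: lp_measurable lpK.
- by rewrite inE; apply: measurableX; exact: measurable_itv.
- by move=> z /Kr[]; rewrite !ltr_norml => ? ?; split; rewrite /I /= in_itv.
Qed.

Lemma measurable_monomial : measurable_fun setT h.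
Proof.
apply: measurable_funM.
  apply: (measurableT_comp (f := horner p^`())); first exact: measurable_horner.
  exact: measurable_fst.
by apply: measurable_funX; exact: measurable_snd.
Qed.

Lemma integrable_monomial : mu2.-integrable K (EFin \o h).
Proof.
apply: measurable_bounded_integrable.
- exact: lp_measurable lpK.
- exact: polygon_finite_measure.
- by apply: measurable_funTS; exact: measurable_monomial.
have [r r0 Kr] := lp_bounded lpK.
have [B hB] := poly_disk_bound p^`() r.
exists (B * r ^+ k); split; first exact: num_real.
move=> M BM z Kz /=; apply: le_trans (ltW BM).
have [zr zr'] := Kr _ Kz.
rewrite normrM ler_pM//; first exact/hB/ltW.
by rewrite normrX lerXn2r ?nnegrE// ltW.
Qed.

Let F : R * R -> \bar R := (EFin \o h) \_ K.

Lemma patch_indic z : F z = (\1_K z * h z)%:E.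
Proof. by rewrite /F patchE indicE; case: (_ \in _); rewrite ?mul1r ?mul0r. Qed.

Lemma integrable_monomial_patch : mu2.-integrable setT F.
Proof.
exact: ((integrable_mkcond (mu := mu2) (EFin \o h) (lp_measurable lpK)).1 integrable_monomial).
Qed.

(** The formula of [section_indicator] is integrated term by term from [- M], a point to the left of
    [K] and of all crossings, to each crossing point. *)
Lemma integral_section y : (forall j, y != (a j).2) ->
  (\int[mu]_x F (x, y) =
    (\sum_(j | crossing a j y) Num.sg (n j).1 * p.[crosspt a j y] * y ^+ k)%:E)%E.
Proof.
move=> hy; have [r r0 Kr] := lp_bounded lpK.
pose M := r + 1 + \sum_j `|crosspt a j y|.
have M0 : r + 1 <= M by rewrite /M lerDl sumr_ge0.
have hM j : - M < crosspt a j y.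
  have : `|crosspt a j y| <= \sum_j `|crosspt a j y|.
    by rewrite (bigD1 j)//= lerDl sumr_ge0.
  have := ler_norm (- crosspt a j y); rewrite normrN /M; lra.
pose Q j := if crossing a j y then (Num.sg (n j).1 * y ^+ k) *: p else 0.
have out x : x <= - M -> \1_K (x, y) = 0 :> R.
  move=> xM; rewrite indicE memNset// => /Kr[/=]; rewrite ltr_norml => /andP[h1 _] _.
  lra.
rewrite (integral_piecewise_poly (s := - M :: [seq crosspt a j y | j : 'I_m]) (Q := Q)
   (lo := fun=> - M) (hi := fun j => crosspt a j y)).
- congr EFin; rewrite sumrB [X in _ - X](_ : _ = 0) ?subr0.
    rewrite [RHS]big_mkcond; apply: eq_bigr => j _; rewrite /Q.
    by case: ifP => _; rewrite ?horner0// hornerZ mulrAC.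
  (* The lower end points contribute nothing: at [- M] the indicator is [0] and every crossing lies
     to the right, so the signs of the crossings add up to [0]. *)
  have := section_indicator lpK hy (x := - M); rewrite out// => /(_ _) sg0.
  transitivity (y ^+ k * p.[- M] *
      \sum_(j | crossing a j y) Num.sg (n j).1 * (- M < crosspt a j y)%R%:R).
    rewrite mulr_sumr [RHS]big_mkcond; apply: eq_bigr => j _; rewrite /Q.
    by case: ifP => _; rewrite ?horner0// hornerZ hM mulr1; ring.
  by rewrite -sg0 ?mulr0// => j _ /eqP; rewrite lt_eqF.
- apply: (@measurableT_comp _ _ _ _ _ _ F _ (fun x => (x, y))).
    by have /integrableP[] := integrable_monomial_patch.
  exact: pair2_measurable.
- by move=> j; rewrite ltW.
- move=> x xs; rewrite patch_indic; congr EFin.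
  have xN j : x <> crosspt a j y.
    move=> xj; move/negP: xs; apply; rewrite inE xj; apply/orP; right.
    by apply/mapP; exists j => //; rewrite mem_enum.
  have [xM|Mx] := leP x (- M).
    have xM' : x != - M by apply: contraNneq xs => ->; rewrite inE eqxx.
    rewrite out// mul0r big1// => j _.
    by rewrite leNgt lt_neqAle xM' xM mul0r.
  rewrite (section_indicator lpK hy)// mulr_suml big_mkcond; apply: eq_bigr => j _.
  rewrite /Q /h /=; case: ifP => _; last by rewrite derivC horner0 mulr0.
  rewrite derivZ hornerZ (ltW Mx)/= lt_neqAle; have /eqP -> := xN j.
  by rewrite /=; ring.
Qed.

(** Change of variables from height to edge parameter, by the chain rule; the signed factor covers
    ascending and descending edges alike. *)
Lemma pint_comp_edge j (q : {poly R}) (r : {poly R}) :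
    q \Po edge_y j = r ->
  (prim q).[(a (ordS j)).2] - (prim q).[(a j).2] = (edge a j).2 * pint r.
Proof.
move=> qr; have := pint_deriv (prim q \Po edge_y j).
rewrite deriv_comp deriv_prim qr /edge_y derivD derivC add0r derivM derivX derivC mulr0 addr0 mul1r.
rewrite mulrC mul_polyC -[_ *: r]addr0 pint_linear (_ : pint 0 = 0); last first.
  by have := pint_linear (-1) (0 : {poly R}) 0; rewrite scaler0 addr0 mulN1r addNr.
rewrite addr0 => ->; rewrite !horner_comp !hornerE /edge/=.
by rewrite [(a j).2 + _]addrC addrK.
Qed.

(** By Fubini the section integrals are integrated over the height, where edge [j] contributes
    between [lo j] and [hi j]. Passing to the edge parameter produces the absolute height difference
    of the edge, which [normal_edge_len] combines with the sign. *)
Lemma integral_dx :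
  (\int[mu2]_(z in K) (h z)%:E =
   (\sum_j edge_len j * (n j).1 * pint ((p \Po edge_x j) * edge_y j ^+ k))%:E)%E.
Proof.
rewrite integral_mkcond -(integral21_prod_meas1 integrable_monomial_patch).
(* [xc j] is [crosspt a j] as a polynomial in the height. On a horizontal edge the inverse of [0] is
   [0], and the term vanishes because [lo j] and [hi j] coincide. *)
pose xc j : {poly R} := (a j).1%:P + ('X - (a j).2%:P) * ((edge a j).2^-1 * (edge a j).1)%:P.
pose q j := (p \Po xc j) * 'X^k.
pose lo j := Num.min (a j).2 (a (ordS j)).2.
pose hi j := Num.max (a j).2 (a (ordS j)).2.
have qE j y : (q j).[y] = p.[crosspt a j y] * y ^+ k.
  by rewrite /q hornerM horner_comp /xc !hornerE. 
rewrite (integral_piecewise_poly (s := [seq (a j).2 | j : 'I_m])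
  (Q := fun j => Num.sg (n j).1 *: prim (q j)) (lo := lo) (hi := hi)).
- congr EFin; apply: eq_bigr => j _.
  rewrite normal_edge_len !hornerZ -mulrBr -mulrA; congr (_ * _).
  have [d0|d0] := eqVneq (edge a j).2 0.
    have e : (a (ordS j)).2 = (a j).2 by apply/eqP; rewrite -subr_eq0; apply/eqP.
    by rewrite d0 normr0 mul0r /lo /hi e maxxx minxx subrr.
  have qr : q j \Po edge_y j = (p \Po edge_x j) * edge_y j ^+ k.
    rewrite /q rmorphM/= rmorphXn/= comp_polyX -comp_polyA; congr ((_ \Po _) * _).
    rewrite /xc rmorphD/= comp_polyC rmorphM/= rmorphB/= comp_polyX !comp_polyC /edge_y.
    by rewrite [(a j).2%:P + _]addrC addrK -mulrA -polyCM mulVKf.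
  have := pint_comp_edge qr.
  have [dp|dn|/eqP] := ltgtP 0 (edge a j).2; last by rewrite eq_sym (negbTE d0).
  + have le : (a j).2 <= (a (ordS j)).2 by rewrite -subr_ge0 ltW.
    by rewrite /lo /hi (min_idPl le) (max_idPr le) gtr0_norm.
  + have le : (a (ordS j)).2 <= (a j).2 by rewrite -subr_le0 ltW.
    rewrite /lo /hi (min_idPr le) (max_idPl le) ltr0_norm// mulNr => <-.
    by rewrite opprB.
- exact: (measurable_fubini_G integrable_monomial_patch).
- by move=> j; rewrite /lo /hi ge_min le_max lexx.
- move=> y ys.
  have hy j : y != (a j).2.
    by apply: contraNneq ys => ->; apply/mapP; exists j => //; rewrite mem_enum.
  rewrite /fubini_G integral_section//; congr EFin.
  rewrite big_mkcond; apply: eq_bigr => j _.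
  rewrite derivZ deriv_prim hornerZ qE.
  have -> : (lo j <= y <= hi j) = crossing a j y.
    rewrite /lo /hi /crossing ge_min le_max !le_eqVlt.
    rewrite ![_ == y]eq_sym (negbTE (hy j)) (negbTE (hy (ordS j)))/=.
    case: (ltgtP y (a j).2) (hy j) => [h1 _|h1 _|_ //];
    case: (ltgtP y (a (ordS j)).2) (hy (ordS j)) => [h2 _|h2 _|_ //];
    by rewrite ?andbF ?andbT ?orbT.
  by case: ifP => _; rewrite ?mul1r ?mul0r// mulrA.
Qed.

End Monomial.
End Green.

Section Swap.
Variables (R : realType) (m : nat) (a n : 'I_m -> R * R) (K : set (R * R)).
Hypothesis lpK : local_polygon a n K.
Local Notation mu := (@lebesgue_measure R).
Local Notation mu2 := ((@lebesgue_measure R) \x (@lebesgue_measure R))%E.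

(** This is [integral_dx] for the polygon with exchanged coordinates. Both double integrals are
    computed as iterated ones, in opposite orders, to see that they agree. *)
Lemma integral_dy (p : {poly R}) k :
  (\int[mu2]_(z in K) (z.1 ^+ k * p^`().[z.2])%:E =
   (\sum_j edge_len a j * (n j).2 * pint (edge_x a j ^+ k * (p \Po edge_y a j)))%:E)%E.
Proof.
have lpS := local_polygon_swap lpK.
pose F' : R * R -> \bar R :=
  (EFin \o (fun z => p^`().[z.1] * z.2 ^+ k)) \_ (@swapp R @^-1` K).
pose F : R * R -> \bar R := (EFin \o (fun z => z.1 ^+ k * p^`().[z.2])) \_ K.
have H := integral_dx lpS p k; rewrite integral_mkcond in H.
rewrite integral_mkcond -[LHS]/(\int[mu2]_z F z)%E.
have iF' : mu2.-integrable setT F' := integrable_monomial_patch lpS p k.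
have FE x y : F (x, y) = F' (y, x).
  rewrite /F /F' !patchE /=.
  have -> : ((y, x) \in @swapp R @^-1` K) = ((x, y) \in K) by apply/idP/idP; rewrite !inE.
  by case: ifP => // _; rewrite mulrC.
have mF : measurable_fun setT F.
  have -> : F = F' \o @swapp R by apply/funext => -[x y]; exact: FE.
  apply: (measurableT_comp (f := F')); first by have /integrableP[] := iF'.
  exact: measurable_fun_pair.
have iF : mu2.-integrable setT F.
  apply/(integrable12ltyP mu mu mF).
  have /integrableP[mF' _] := iF'; have := (integrable21ltyP mu mu mF').1 iF'.
  by under [X in (X < _)%E -> _]eq_integral do under eq_integral do rewrite -FE.
have -> : (\int[mu2]_z F z = \int[mu2]_z F' z)%E.
  rewrite -(integral12_prod_meas1 iF) -(integral21_prod_meas1 iF') /fubini_F /fubini_G.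
  by apply: eq_integral => x _; apply: eq_integral => y _; rewrite FE.
rewrite H; congr EFin; apply: eq_bigr => j _; congr (_ * _ * pint _); last by rewrite mulrC.
by rewrite /edge_len addrC.
Qed.

End Swap.

(** * Complex polynomials and their boundary traces *)

Lemma poly_eq0_injective (F : idomainType) (p : {poly F}) (f : nat -> F) :
  injective f -> (forall i, p.[f i] = 0) -> p = 0.
Proof.
move=> fi pf; apply: contrapT => /eqP p0.
have := max_poly_roots p0 (rs := mkseq f (size p)).
rewrite size_mkseq ltnn => h; suff: false by []. apply: h.
  by apply/allP => _ /mapP[i _ ->]; rewrite rootE pf.
by rewrite mkseq_uniq.
Qed.

Section RealPoly.
Variable R : realType.
Local Notation C := R[i].
Implicit Types (p q : {poly R}) (r : {poly C}).

(** The embedding [f] will be the identity, the inclusion of the reals in [C], or that of the reals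
    in [{poly C}] as constants. *)
Lemma horner_zero_itv (F : idomainType) (f : {rmorphism R -> F}) (r : {poly F}) (a b : R) :
  injective f -> a < b -> (forall x, a < x < b -> r.[f x] = 0) -> r = 0.
Proof.
move=> fi ab h.
(* Infinitely many distinct points; the denominators start at [2] to stay strictly below [b]. *)
apply: (@poly_eq0_injective _ r (fun i => f (a + (b - a) / i.+2%:R))).
  move=> i j /fi /addrI /mulfI; rewrite subr_eq0 gt_eqF// => /(_ isT) /invr_inj /eqP.
  by rewrite eqr_nat => /eqP [].
move=> i; apply: h; apply/andP; split.
  by rewrite ltrDl divr_gt0// subr_gt0.
by rewrite -ltrBrDl ltr_pdivrMr// ltr_pMr ?subr_gt0// ltr1n.
Qed.

Lemma pint_ge0 p : (forall x, 0 <= p.[x]) -> 0 <= pint p.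
Proof.
move=> p0; have := @integral_deriv_poly R (prim p) 0 1 ler01.
rewrite deriv_prim prim0 subr0 -/(pint p) -lee_fin => <-.
by apply: integral_ge0 => x _; rewrite lee_fin.
Qed.

(** The primitive is nondecreasing and takes the value [0] at both [0] and [1], so it vanishes in
    between. *)
Lemma pint_eq0 p : (forall x, 0 <= p.[x]) -> pint p = 0 -> p = 0.
Proof.
move=> p0 ip; rewrite -(deriv_prim p).
suff -> : prim p = 0 by rewrite deriv0.
have mono x y : x <= y -> (prim p).[x] <= (prim p).[y].
  move=> xy; rewrite -subr_ge0 -lee_fin -(integral_deriv_poly _ xy).
  by apply: integral_ge0 => z _; rewrite deriv_prim lee_fin.
apply: (@horner_zero_itv _ idfun _ 0 1 (@inj_id _)) => // x /andP[x0 x1] /=.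
apply/eqP; rewrite eq_le; apply/andP; split.
  by rewrite -ip; apply: mono; exact: ltW.
by rewrite -(prim0 p); apply: mono; exact: ltW.
Qed.

Local Notation rc := (real_complex R).

Lemma pint_map p : pint (map_poly rc p) = rc (pint p).
Proof.
rewrite /pint; have -> : prim (map_poly rc p) = map_poly rc (prim p).
  apply/polyP => i; rewrite coef_prim !coef_map coef_prim/= rmorphM/= fmorphV.
  by rewrite rmorph_nat.
by rewrite -[1 in LHS](rmorph1 rc) horner_map.
Qed.

Lemma conj_rc (x : R) : conjc (rc x) = rc x.
Proof. exact: conjc_real. Qed.

Definition Rep r : {poly R} := map_poly (@complex.Re R) r.
Definition Imp r : {poly R} := map_poly (@complex.Im R) r.

Lemma coef_Rep r i : (Rep r)`_i = complex.Re r`_i.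
Proof. by rewrite coef_map_id0. Qed.

Lemma coef_Imp r i : (Imp r)`_i = complex.Im r`_i.
Proof. by rewrite coef_map_id0. Qed.

Lemma poly_ReIm r : r = map_poly rc (Rep r) + ('i%C)%:P * map_poly rc (Imp r).
Proof.
apply/polyP => i; rewrite coefD coefCM [(map_poly rc (Rep r))`_i]coef_map.
by rewrite [(map_poly rc (Imp r))`_i]coef_map coef_Rep coef_Imp [LHS]complexE.
Qed.

(** At real points its value is the conjugate of that of [r], so [r * conjp r] is a polynomial that
    represents [|r|^2] there. *)
Definition conjp r : {poly C} := map_poly (@conjc R) r.

Lemma coef_conjp r i : (conjp r)`_i = conjc r`_i.
Proof. by rewrite coef_map_id0// conjc0. Qed.

Lemma conjpK r : conjp (conjp r) = r.
Proof. by apply/polyP => i; rewrite !coef_conjp conjcK. Qed.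

Lemma conjp0 : conjp (0 : {poly C}) = 0. Proof. by rewrite /conjp map_poly0. Qed.

Lemma conjp_rc p : conjp (map_poly rc p) = map_poly rc p.
Proof.
apply/polyP => i; rewrite [LHS]coef_map_id0 ?conjc0// [(map_poly rc p)`_i]coef_map.
exact: conjc_real.
Qed.

Lemma conjpD r r' : conjp (r + r') = conjp r + conjp r'.
Proof. exact: rmorphD. Qed.

Lemma conjpM r r' : conjp (r * r') = conjp r * conjp r'.
Proof. exact: rmorphM. Qed.

Lemma poly_mul_conj r : r * conjp r = map_poly rc (Rep r ^+ 2 + Imp r ^+ 2).
Proof.
rewrite {1 2}(poly_ReIm r) conjpD conjpM !conjp_rc.
have -> : conjp ('i%C)%:P = - ('i%C)%:P.
  have ci : conjc ('i%C : C) = - 'i%C by apply/eqP; rewrite eq_complex/= oppr0 !eqxx.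
  by rewrite /conjp map_polyC -polyCN -ci.
rewrite rmorphD/= !rmorphXn/=.
set u := map_poly rc (Rep r); set v := map_poly rc (Imp r).
have ii : ('i%C)%:P * ('i%C)%:P = -1 :> {poly C}.
  by rewrite -polyCM -expr2 sqr_i polyCN polyC1.
transitivity (u ^+ 2 - ('i%C)%:P * ('i%C)%:P * v ^+ 2); last by rewrite ii mulN1r opprK.
by ring.
Qed.

Lemma pint_mul_conj_ge0 r : 0 <= pint (r * conjp r).
Proof.
rewrite poly_mul_conj pint_map lecR; apply: pint_ge0 => x.
by rewrite hornerD !horner_exp addr_ge0 ?sqr_ge0.
Qed.

Lemma pint_mul_conj_eq0 r : pint (r * conjp r) = 0 -> r = 0.
Proof.
move=> h; have : pint (Rep r ^+ 2 + Imp r ^+ 2) = 0.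
  by move: h; rewrite poly_mul_conj pint_map => /(congr1 (@complex.Re R)).
move=> /pint_eq0 e0; have /eqP : r * conjp r = 0.
  rewrite poly_mul_conj e0 ?rmorph0// => x.
  by rewrite hornerD !horner_exp addr_ge0 ?sqr_ge0.
rewrite mulf_eq0 => /orP[/eqP//|/eqP cr].
by rewrite -[r]conjpK cr conjp0.
Qed.

End RealPoly.

Section Restriction.
Variables (F : comNzRingType) (ex ey : {poly F}).
Implicit Types p q : {poly {poly F}}.

Definition subst2 p : {poly F} := (map_poly (comp_poly ey) p).[ex].

Lemma subst2D p q : subst2 (p + q) = subst2 p + subst2 q.
Proof. by rewrite /subst2 rmorphD/= hornerD. Qed.

Lemma subst2M p q : subst2 (p * q) = subst2 p * subst2 q.
Proof. by rewrite /subst2 rmorphM/= hornerM. Qed.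

Lemma subst2_0 : subst2 0 = 0.
Proof. by rewrite /subst2 rmorph0 horner0. Qed.

Lemma subst2C c : subst2 c%:P%:P = c%:P.
Proof. by rewrite /subst2 map_polyC/= comp_polyC hornerC. Qed.

Lemma subst2Z c p : subst2 (c%:P%:P * p) = c *: subst2 p.
Proof. by rewrite subst2M subst2C mul_polyC. Qed.

Lemma subst2_monomial i k : subst2 ('X^i * ('X^k)%:P) = ex ^+ i * ey ^+ k.
Proof.
by rewrite /subst2 rmorphM/= map_polyXn map_polyC/= comp_Xn_poly hornerM hornerXn hornerC.
Qed.

End Restriction.

Lemma map_deriv_scale (F : nzRingType) (c : F) (p : {poly {poly F}}) :
  map_poly deriv (c%:P%:P * p) = c%:P%:P * map_poly deriv p.
Proof.
apply/polyP => i; rewrite coefCM !coef_map_id0 ?deriv0// coefCM.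
by rewrite derivM derivC mul0r add0r.
Qed.

Lemma deriv_scale (F : nzRingType) (c : F) (p : {poly F}) : (c%:P * p)^`() = c%:P * p^`().
Proof. by rewrite derivM derivC mul0r add0r. Qed.

Lemma map_deriv_monomial (F : nzRingType) i (q : {poly F}) :
  map_poly deriv ('X^i * q%:P) = 'X^i * (q^`())%:P.
Proof.
apply/polyP => l; rewrite coef_map_id0 ?deriv0// !coefMC coefXn.
by case: (l == i); rewrite ?mul1r ?mul0r ?deriv0.
Qed.

Lemma horner2_derivX (F : comNzRingType) i k (x y : F) :
  ((('X^i)^`() * ('X^k)%:P) : {poly {poly F}}).[x%:P].[y] = x ^+ i.-1 *+ i * y ^+ k.
Proof.
by rewrite derivXn hornerM hornerMn hornerXn hornerC hornerM hornerMn -polyC_exp hornerC hornerXn.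
Qed.

Lemma horner2_derivY (F : comNzRingType) i k (x y : F) :
  (('X^i * (('X^k)^`())%:P) : {poly {poly F}}).[x%:P].[y] = x ^+ i * (y ^+ k.-1 *+ k).
Proof.
by rewrite derivXn hornerM hornerXn hornerC hornerM hornerMn -polyC_exp hornerC hornerXn.
Qed.

Section BoundaryTraces.
Variables (R : realType) (m : nat) (a n : 'I_m -> R * R).
Local Notation C := R[i].
Local Notation rc := (real_complex R).
Implicit Types (p q : Pol R) (w : Pol R * Pol R).

Definition mono i k : Pol R := 'X^i * ('X^k)%:P.

(** Reduces linear and conjugate-linear identities to monomials, for which the integrals have been
    computed. *)
Lemma Pol_ind (P : Pol R -> Prop) : P 0 -> (forall p q, P p -> P q -> P (p + q)) ->
  (forall c i k, P (scP c (mono i k))) -> forall p, P p.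
Proof.
move=> P0 PD Pm p; rewrite -[p]coefK poly_def.
elim/big_ind: _ => // i _; rewrite -[p`_i]coefK poly_def scaler_suml.
elim/big_ind: _ => // k _; rewrite -!mul_polyC polyCM.
suff -> : ((p`_i)`_k)%:P%:P * ('X^k)%:P * 'X^i = scP (p`_i)`_k (mono i k) by exact: Pm.
by rewrite /scP /mono -mulrA; congr (_ * _); rewrite mulrC.
Qed.

Lemma pevalE p (x : R * R) : peval p x = (p.[(rc x.1)%:P]).[rc x.2].
Proof. by []. Qed.

Lemma pevalD p q x : peval (p + q) x = peval p x + peval q x.
Proof. by rewrite !pevalE !hornerD. Qed.

Lemma pevalM p q x : peval (p * q) x = peval p x * peval q x.
Proof. by rewrite !pevalE !hornerM. Qed.

Lemma peval0 x : peval 0 x = 0 :> C.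
Proof. by rewrite pevalE !horner0. Qed.

Lemma pevalC c x : peval c%:P%:P x = c :> C.
Proof. by rewrite pevalE !hornerC. Qed.

Lemma pevalZ c p x : peval (scP c p) x = c * peval p x.
Proof. by rewrite pevalM pevalC. Qed.

Lemma peval_mono i k (x : R * R) : peval (mono i k) x = rc (x.1 ^+ i * x.2 ^+ k).
Proof.
rewrite pevalE /mono hornerM hornerXn hornerC hornerM -polyC_exp hornerC hornerXn.
by rewrite rmorphM/= !rmorphXn.
Qed.

Definition restr j p : {poly C} :=
  subst2 (map_poly rc (edge_x a j)) (map_poly rc (edge_y a j)) p.

Lemma restrD j p q : restr j (p + q) = restr j p + restr j q.
Proof. exact: subst2D. Qed.

Lemma restrM j p q : restr j (p * q) = restr j p * restr j q.
Proof. exact: subst2M. Qed.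

Lemma restr0 j : restr j 0 = 0.
Proof. exact: subst2_0. Qed.

Lemma restrC j c : restr j c%:P%:P = c%:P.
Proof. exact: subst2C. Qed.

Lemma restrZ j c p : restr j (scP c p) = c *: restr j p.
Proof. exact: subst2Z. Qed.

Lemma restr_mono j i k :
  restr j (mono i k) = map_poly rc (edge_x a j ^+ i * edge_y a j ^+ k).
Proof. by rewrite rmorphM/= !rmorphXn/=; exact: subst2_monomial. Qed.

Lemma restrE j p t : (restr j p).[rc t] = peval p (ept a j t).
Proof.
elim/Pol_ind: p => [|p q hp hq|c i k]; first by rewrite restr0 horner0 peval0.
  by rewrite restrD hornerD hp hq pevalD.
rewrite restrZ hornerZ pevalZ restr_mono horner_map/= peval_mono.
by rewrite hornerM !horner_exp edge_xE edge_yE.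
Qed.

Definition cj p : Pol R := map_poly (@conjp R) p.

Lemma cjD p q : cj (p + q) = cj p + cj q.
Proof.
by apply/polyP => i; rewrite coefD !coef_map_id0 ?coefD ?conjpD// /conjp map_poly0.
Qed.

Lemma coef_cj p i : (cj p)`_i = conjp p`_i.
Proof. by rewrite coef_map_id0// conjp0. Qed.

Lemma cjK p : cj (cj p) = p.
Proof. by apply/polyP => i; rewrite !coef_cj conjpK. Qed.

Lemma cjM p q : cj (p * q) = cj p * cj q.
Proof. exact: (rmorphM (map_poly (map_poly (@conjc R)))). Qed.

Lemma cj0 : cj 0 = 0. Proof. by rewrite /cj map_poly0. Qed.

Lemma cjN p : cj (- p) = - cj p.
Proof. by apply/eqP; rewrite -addr_eq0 -cjD addNr cj0. Qed.

Lemma cj_scmono c i k : cj (scP c (mono i k)) = scP (conjc c) (mono i k).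
Proof.
apply/polyP => l; rewrite /cj coef_map_id0 ?conjp0// /scP /mono !coefCM !coefMC !coefXn.
case: (l == i); last by rewrite !mul0r !mulr0 conjp0.
rewrite !mul1r conjpM /conjp map_polyC/=; congr (_ * _).
by rewrite map_polyXn.
Qed.

Lemma peval_cj p x : peval (cj p) x = (peval p x)^*.
Proof.
elim/Pol_ind: p => [|p q hp hq|c i k]; first by rewrite cj0 peval0 rmorph0.
  by rewrite cjD !pevalD rmorphD/= hp hq.
rewrite cj_scmono !pevalZ rmorphM/= peval_mono; congr (_ * _).
by rewrite -[in LHS]conj_rc.
Qed.

Lemma restr_cj j p : restr j (cj p) = conjp (restr j p).
Proof.
elim/Pol_ind: p => [|p q hp hq|c i k]; first by rewrite cj0 restr0 /conjp map_poly0.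
  by rewrite cjD !restrD conjpD/= hp hq.
rewrite cj_scmono !restrZ -!mul_polyC conjpM restr_mono conjp_rc; congr (_ * _).
by rewrite /conjp map_polyC.
Qed.

Lemma dXD p q : dX (p + q) = dX p + dX q. Proof. exact: derivD. Qed.
Lemma dXM p q : dX (p * q) = dX p * q + p * dX q. Proof. exact: derivM. Qed.
Lemma dX0 : dX (0 : Pol R) = 0. Proof. exact: deriv0. Qed.

Lemma coef_dY p i : (dY p)`_i = (p`_i)^`().
Proof. by rewrite coef_map_id0// deriv0. Qed.

Lemma dYD p q : dY (p + q) = dY p + dY q.
Proof. by apply/polyP => i; rewrite !(coef_dY, coefD) derivD. Qed.

Lemma dY0 : dY (0 : Pol R) = 0. Proof. by rewrite /dY map_poly0. Qed.

Lemma dYM p q : dY (p * q) = dY p * q + p * dY q.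
Proof.
apply/polyP => i; rewrite coefD coef_dY !coefM raddf_sum -big_split/=.
by apply: eq_bigr => k _; rewrite derivM !coef_dY.
Qed.

Lemma dX_scP c p : dX (scP c p) = scP c (dX p).
Proof. exact: deriv_scale. Qed.

Lemma dY_scP c p : dY (scP c p) = scP c (dY p).
Proof. exact: map_deriv_scale. Qed.

Lemma peval_dX_mono i k (x : R * R) :
  peval (dX (mono i k)) x = rc (('X^i)^`().[x.1] * x.2 ^+ k).
Proof.
have -> : dX (mono i k) = ('X^i)^`() * ('X^k)%:P by rewrite /mono dXM /dX derivC mulr0 addr0.
rewrite pevalE [in RHS]derivXn [in RHS]hornerMn [in RHS]hornerXn.
rewrite [in RHS]rmorphM [in RHS]rmorphMn ![in RHS]rmorphXn.
exact: horner2_derivX.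
Qed.

Lemma peval_dY_mono i k (x : R * R) :
  peval (dY (mono i k)) x = rc (x.1 ^+ i * ('X^k)^`().[x.2]).
Proof.
have -> : dY (mono i k) = 'X^i * (('X^k)^`())%:P by exact: map_deriv_monomial.
rewrite pevalE [in RHS]derivXn [in RHS]hornerMn [in RHS]hornerXn.
rewrite [in RHS]rmorphM [in RHS]rmorphMn ![in RHS]rmorphXn.
exact: horner2_derivY.
Qed.

Lemma cj_dX p : cj (dX p) = dX (cj p).
Proof.
apply/polyP => i; rewrite /cj /dX coef_deriv !coef_map_id0 ?conjp0//.
by rewrite coef_deriv; exact: rmorphMn.
Qed.

Lemma cj_dY p : cj (dY p) = dY (cj p).
Proof.
apply/polyP => i; rewrite coef_dY /cj !coef_map_id0 ?conjp0 ?deriv0//.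
exact/esym/deriv_map.
Qed.

End BoundaryTraces.

(** * Green's formula *)

Section ComplexIntegral.
Variables (R : realType) (m : nat) (a n : 'I_m -> R * R) (K : set (R * R)).
Hypothesis lpK : local_polygon a n K.
Local Notation C := R[i].
Local Notation rc := (real_complex R).
Local Notation mu2 := ((@lebesgue_measure R) \x (@lebesgue_measure R))%E.
Implicit Types (p q : Pol R) (f g : R * R -> C).

Let mK : measurable K. Proof. exact: lp_measurable lpK. Qed.

Definition cintegrable f :=
  mu2.-integrable K (EFin \o (fun x => complex.Re (f x))) /\
  mu2.-integrable K (EFin \o (fun x => complex.Im (f x))).

Lemma eq_integrable_fun (u v : R * R -> \bar R) : u =1 v ->
  mu2.-integrable K u -> mu2.-integrable K v.
Proof. by move=> /funext ->. Qed.

Lemma cintegrableD f g : cintegrable f -> cintegrable g -> cintegrable (fun x => f x + g x).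
Proof.
move=> [f1 f2] [g1 g2]; split.
  apply: (eq_integrable_fun _ (integrableD (mu := mu2) mK f1 g1)) => x /=.
  by case: (f x) (g x) => ? ? [].
apply: (eq_integrable_fun _ (integrableD (mu := mu2) mK f2 g2)) => x /=.
by case: (f x) (g x) => ? ? [].
Qed.

Lemma cintegrableZ c f : cintegrable f -> cintegrable (fun x => c * f x).
Proof.
case: c => c1 c2 [f1 f2]; split.
  have := integrableB (mu := mu2) mK (integrableZl (mu := mu2) mK c1 f1)
    (integrableZl (mu := mu2) mK c2 f2).
  by apply: eq_integrable_fun => x /=; case: (f x).
have := integrableD (mu := mu2) mK (integrableZl (mu := mu2) mK c1 f2)
    (integrableZl (mu := mu2) mK c2 f1).
by apply: eq_integrable_fun => x /=; case: (f x).
Qed.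

Lemma cintKD f g : cintegrable f -> cintegrable g ->
  cintK K (fun x => f x + g x) = cintK K f + cintK K g.
Proof.
move=> [f1 f2] [g1 g2]; rewrite /cintK.
have -> : (fun x => complex.Re (f x + g x)) = (fun x => complex.Re (f x) + complex.Re (g x)).
  by apply/funext => x; case: (f x) (g x) => ? ? [].
have -> : (fun x => complex.Im (f x + g x)) = (fun x => complex.Im (f x) + complex.Im (g x)).
  by apply/funext => x; case: (f x) (g x) => ? ? [].
rewrite (RintegralD (mu := mu2) mK f1 g1) (RintegralD (mu := mu2) mK f2 g2) !rmorphD/= mulrDr.
by rewrite addrACA.
Qed.

Lemma cintKZ c f : cintegrable f -> cintK K (fun x => c * f x) = c * cintK K f.
Proof.
case: c => c1 c2 [f1 f2]; rewrite /cintK.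
have -> : (fun x => complex.Re ((c1 +i* c2)%C * f x)) =
          (fun x => c1 * complex.Re (f x) - c2 * complex.Im (f x)).
  by apply/funext => x; case: (f x).
have -> : (fun x => complex.Im ((c1 +i* c2)%C * f x)) =
          (fun x => c1 * complex.Im (f x) + c2 * complex.Re (f x)).
  by apply/funext => x; case: (f x).
have Z c (h : R * R -> R) : mu2.-integrable K (EFin \o h) ->
    mu2.-integrable K (EFin \o (fun x => c * h x)) :=
  integrableZl (mu := mu2) mK c (f := EFin \o h).
rewrite (RintegralB (mu := mu2) mK (Z c1 _ f1) (Z c2 _ f2)).
rewrite (RintegralD (mu := mu2) mK (Z c1 _ f2) (Z c2 _ f1)).
rewrite !(RintegralZl (mu := mu2) _ mK f1) !(RintegralZl (mu := mu2) _ mK f2).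
set A := Rintegral _ _ _; set B := Rintegral _ _ _.
by apply/eqP; rewrite eq_complex/=; apply/andP; split; apply/eqP; ring.
Qed.

Lemma cintK_real (h : R * R -> R) : cintK K (fun x => rc (h x)) = rc (Rintegral mu2 K h).
Proof.
rewrite /cintK /=; have -> : Rintegral mu2 K (fun=> 0) = 0 by rewrite Rintegral_cst// mul0r.
by rewrite rmorph0 mulr0 addr0.
Qed.

Lemma cintegrable_real (h : R * R -> R) :
  mu2.-integrable K (EFin \o h) -> cintegrable (fun x => rc (h x)).
Proof. by move=> hi; split => //=; exact: integrable0. Qed.

Lemma cintegrable_peval p : cintegrable (peval p).
Proof.
elim/Pol_ind: p => [|p q hp hq|c i k].
- have -> : peval (0 : Pol R) = (fun x => rc 0) by apply/funext => x; rewrite peval0.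
  apply: cintegrable_real; exact: integrable0.
- have -> : peval (p + q) = (fun x => peval p x + peval q x).
    by apply/funext => x; rewrite pevalD.
  exact: cintegrableD.
- have -> : peval (scP c (mono R i k)) = (fun x => c * rc (x.1 ^+ i * x.2 ^+ k)).
    by apply/funext => x; rewrite pevalZ peval_mono.
  apply/cintegrableZ/cintegrable_real.
  have := integrable_monomial lpK (prim 'X^i) k.
  by apply: eq_integrable_fun => x; rewrite /= deriv_prim hornerXn.
Qed.

Definition pintK p := cintK K (peval p).

Lemma pintKD p q : pintK (p + q) = pintK p + pintK q.
Proof.
rewrite /pintK -cintKD; [|exact: cintegrable_peval..].
by congr cintK; apply/funext => x; rewrite pevalD.
Qed.

Lemma pintKZ c p : pintK (scP c p) = c * pintK p.
Proof.
rewrite /pintK -cintKZ; last exact: cintegrable_peval.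
by congr cintK; apply/funext => x; rewrite pevalZ.
Qed.

Lemma pintK0 : pintK 0 = 0.
Proof.
have e : scP 0 0 = 0 :> Pol R by exact: mulr0.
by have := pintKZ 0 0; rewrite e mul0r.
Qed.

Lemma pintKN p : pintK (- p) = - pintK p.
Proof. by apply/eqP; rewrite -addr_eq0 -pintKD addNr pintK0. Qed.

Lemma pintK_real p (h : R * R -> R) : (forall x, peval p x = rc (h x)) ->
  pintK p = rc (Rintegral mu2 K h).
Proof. by move=> ph; rewrite -cintK_real; congr cintK; apply/funext. Qed.

Lemma pint0 : pint (0 : {poly C}) = 0.
Proof. by have := pint_linear (-1) (0 : {poly C}) 0; rewrite scaler0 addr0 mulN1r addNr. Qed.

Lemma pintD (r s : {poly C}) : pint (r + s) = pint r + pint s.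
Proof. by rewrite -[in LHS](scale1r r) pint_linear mul1r. Qed.

Lemma pintZ c (r : {poly C}) : pint (c *: r) = c * pint r.
Proof. by rewrite -[c *: r]addr0 pint_linear pint0 addr0. Qed.

Lemma pintN (r : {poly C}) : pint (- r) = - pint r.
Proof. by rewrite -scaleN1r pintZ mulN1r. Qed.

Lemma divergence_x p :
  pintK (dX p) = \sum_j rc (edge_len a j * (n j).1) * pint (restr a j p).
Proof.
elim/Pol_ind: p => [|p q hp hq|c i k].
- by rewrite dX0 pintK0 big1// => j _; rewrite restr0 pint0 mulr0.
- rewrite dXD pintKD hp hq -big_split; apply: eq_bigr => j _.
  by rewrite restrD pintD mulrDr.
rewrite dX_scP pintKZ (pintK_real (peval_dX_mono i k)) /Rintegral (integral_dx lpK)/=.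
rewrite rmorph_sum mulr_sumr; apply: eq_bigr => j _.
by rewrite restrZ pintZ restr_mono pint_map comp_Xn_poly rmorphM mulrCA.
Qed.

Lemma divergence_y p :
  pintK (dY p) = \sum_j rc (edge_len a j * (n j).2) * pint (restr a j p).
Proof.
elim/Pol_ind: p => [|p q hp hq|c i k].
- by rewrite dY0 pintK0 big1// => j _; rewrite restr0 pint0 mulr0.
- rewrite dYD pintKD hp hq -big_split; apply: eq_bigr => j _.
  by rewrite restrD pintD mulrDr.
rewrite dY_scP pintKZ (pintK_real (peval_dY_mono i k)) /Rintegral (integral_dy lpK)/=.
rewrite rmorph_sum mulr_sumr; apply: eq_bigr => j _.
by rewrite restrZ pintZ restr_mono pint_map comp_Xn_poly rmorphM mulrCA.
Qed.

Lemma ipSE p q : ipS K p q = pintK (p * cj q).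
Proof. by congr cintK; apply/funext => x; rewrite pevalM peval_cj. Qed.

Lemma ipSC p q : ipS K p q = (ipS K q p)^*.
Proof.
have Jcj r : pintK (cj r) = (pintK r)^*.
  elim/Pol_ind: r => [|r s hr hs|c i k]; first by rewrite cj0 pintK0 rmorph0.
    by rewrite cjD !pintKD rmorphD/= hr hs.
  rewrite cj_scmono !pintKZ rmorphM/= (pintK_real (peval_mono i k)); congr (_ * _).
  by rewrite -[in LHS]conj_rc.
by rewrite !ipSE -Jcj cjM cjK mulrC.
Qed.

Lemma ipS_linear c p q r : ipS K (scP c p + q) r = c * ipS K p r + ipS K q r.
Proof. by rewrite !ipSE mulrDl pintKD -mulrA pintKZ. Qed.

(* The tangential trace [n x w] on edge [j]. *)
Definition tang j (w : Pol R * Pol R) : {poly C} :=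
  - (rc (n j).2 *: restr a j w.1) + rc (n j).1 *: restr a j w.2.

(** The divergence theorem for the field with components [w.2] and [- w.1], each times the conjugate
    of [v]; its normal flux is [n x w] times that conjugate. *)
Lemma green_curl (v : Pol R) (w : Pol R * Pol R) :
  ipS K (curl_v w) v - ipV K w (curl_s v) =
  \sum_j rc (edge_len a j) * pint (tang j w * conjp (restr a j v)).
Proof.
transitivity (pintK (dX (w.2 * cj v)) - pintK (dY (w.1 * cj v))).
  rewrite /ipV !ipSE /curl_v /curl_s /= cjN mulrN pintKN cj_dX cj_dY dXM dYM.
  rewrite mulrDl mulNr !pintKD pintKN; ring.
rewrite divergence_x divergence_y -sumrB; apply: eq_bigr => j _.
rewrite /tang mulrDl mulNr -!scalerAl !restrM !restr_cj pintD pintN !pintZ !rmorphM/=.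
ring.
Qed.

Lemma continuous_peval p :
  continuous (fun z : R * R => complex.Re (peval p z)) /\
  continuous (fun z : R * R => complex.Im (peval p z)).
Proof.
elim/Pol_ind: p => [|p q [p1 p2] [q1 q2]|[c1 c2] i k].
- by split; under eq_fun do rewrite peval0; exact: cst_continuous.
- split.
    have -> : (fun z => complex.Re (peval (p + q) z)) =
      (fun z => complex.Re (peval p z) + complex.Re (peval q z)).
      by apply/funext => z; rewrite pevalD; case: (peval p z) (peval q z) => ? ? [].
    by move=> z; exact: cvgD (p1 z) (q1 z).
  have -> : (fun z => complex.Im (peval (p + q) z)) =
    (fun z => complex.Im (peval p z) + complex.Im (peval q z)).
    by apply/funext => z; rewrite pevalD; case: (peval p z) (peval q z) => ? ? [].
  by move=> z; exact: cvgD (p2 z) (q2 z).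
- have c z : continuous_at z (fun z : R * R => ('X^i : {poly R}).[z.1] * ('X^k : {poly R}).[z.2]).
    apply: cvgM; apply: (continuous_comp _ (@continuous_horner _ _ _)).
      exact: cvg_fst.
    exact: cvg_snd.
  have E z : peval (scP (c1 +i* c2)%C (mono R i k)) z =
     (c1 +i* c2)%C * rc (('X^i : {poly R}).[z.1] * ('X^k : {poly R}).[z.2]).
    by rewrite pevalZ peval_mono !hornerXn.
  split=> z.
    rewrite (_ : (fun z => _) = (fun z : R * R =>
        c1 * (('X^i : {poly R}).[z.1] * ('X^k : {poly R}).[z.2]))).
      exact: cvgMr (c z).
    by apply/funext => u; rewrite E /= mulr0 subr0.
  rewrite (_ : (fun z => _) = (fun z : R * R =>
        c2 * (('X^i : {poly R}).[z.1] * ('X^k : {poly R}).[z.2]))).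
    exact: cvgMr (c z).
  by apply/funext => u; rewrite E /= mulr0 add0r.
Qed.

(** One variable at a time: the evaluation in the first variable takes values in [{poly C}], and
    each of these vanishes by the argument in the second variable. *)
Lemma peval_box_eq0 p (z : R * R) e : 0 < e -> (forall u, box z e u -> peval p u = 0) -> p = 0.
Proof.
move=> e0 h.
have itv (c x : R) : c < x < c + e -> `|c - x| < e.
  by move=> /andP[h1 h2]; rewrite ltr_distl; apply/andP; split; lra.
pose f : {rmorphism R -> {poly C}} := GRing.RMorphism.clone _ _ (polyC \o rc) _.
apply: (@horner_zero_itv _ _ f _ z.1 (z.1 + e)).
- by move=> x y /polyC_inj /(congr1 (@complex.Re R)).
- by rewrite ltrDl.
- move=> x xz; apply: (@horner_zero_itv _ _ rc _ z.2 (z.2 + e)).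
  + by move=> u v /(congr1 (@complex.Re R)).
  + by rewrite ltrDl.
  + by move=> y yz; apply: (h (x, y)); split; exact: itv.
Qed.

Lemma boxE (z : R * R) e : box z e = `]z.1 - e, z.1 + e[%classic `*` `]z.2 - e, z.2 + e[%classic.
Proof.
apply/seteqP; split=> u [] /=; rewrite !in_itv/= => h1 h2.
  by move: h1 h2; rewrite !ltr_distl => /andP[? ?] /andP[? ?]; split; apply/andP; split; lra.
by move: h1 h2 => /andP[? ?] /andP[? ?]; split; rewrite ltr_distl; apply/andP; split; lra.
Qed.

Lemma measurable_box (z : R * R) e : measurable (box z e).
Proof. by rewrite boxE; apply: measurableX; exact: measurable_itv. Qed.

Lemma box_measure_gt0 (z : R * R) e : 0 < e -> (0 < mu2 (box z e))%E.
Proof.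
move=> e0; pose I (x : R) : set R := `]x - e, x + e[%classic.
rewrite boxE -/(I z.1) -/(I z.2).
have -> : mu2 (I z.1 `*` I z.2) = (lebesgue_measure (I z.1) * lebesgue_measure (I z.2))%E.
  by apply: product_measure1E; exact: measurable_itv.
have mI x : (lebesgue_measure (I x) = (e + e)%:E)%E.
  rewrite lebesgue_measure_itv/= lte_fin ifT; last by lra.
  by rewrite -EFinD; congr EFin; lra.
by rewrite !mI -EFinM lte_fin mulr_gt0// addr_gt0.
Qed.

Lemma ipS_sqr p : ipS K p p =
  rc (Rintegral mu2 K (fun z => complex.Re (peval p z) ^+ 2 + complex.Im (peval p z) ^+ 2)).
Proof.
rewrite ipSE; apply: pintK_real => z; rewrite pevalM peval_cj; case: (peval p z) => x y /=.
by apply/eqP; rewrite eq_complex/=; apply/andP; split; apply/eqP; ring.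
Qed.

Lemma ipS_ge0 p : 0 <= ipS K p p.
Proof.
by rewrite ipS_sqr lecR; apply: Rintegral_ge0 => z _; rewrite addr_ge0 ?sqr_ge0.
Qed.

Hypotheses (oK : open K) (K0 : K !=set0).

(** The squared modulus vanishes almost everywhere on [K]. By continuity it vanishes everywhere
    there, since a nonzero value would persist on a box of positive measure. So [p] vanishes on a
    box. *)
Lemma ipS_eq0 p : ipS K p p = 0 -> p = 0.
Proof.
pose f (z : R * R) := complex.Re (peval p z) ^+ 2 + complex.Im (peval p z) ^+ 2.
rewrite ipS_sqr -/f => /(congr1 (@complex.Re R))/= f0.
have fE z : complex.Re (peval (p * cj p) z) = f z.
  by rewrite pevalM peval_cj /f; case: (peval p z) => x y /=; ring.
have fi : mu2.-integrable K (EFin \o f).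
  have [+ _] := cintegrable_peval (p * cj p).
  by apply: eq_integrable_fun => z; rewrite /= fE.
have f_ge0 z : 0 <= f z by rewrite /f addr_ge0 ?sqr_ge0.
have if0 : (\int[mu2]_(z in K) `|(EFin \o f) z| = 0)%E.
  rewrite -[RHS]/(0%:E) -f0 /Rintegral fineK; last exact: integrable_fin_num.
  by apply: eq_integral => z _; rewrite gee0_abs// lee_fin.
have mf : measurable_fun K (EFin \o f) by have /integrableP[] := fi.
have [N [mN N0 fN]] := (ae_eq_integral_abs mu2 mK mf).1 if0.
have cf : continuous f.
  have [c1 c2] := continuous_peval p.
  by move=> z; apply: cvgD; apply: cvgM; [exact: c1|exact: c1|exact: c2|exact: c2].
have fK z : K z -> f z = 0.
  move=> Kz; apply: contrapT => /eqP fz.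
  have : nbhs z (K `&` [set u | f u != 0]).
    apply: filterI; first exact: open_nbhs_nbhs.
    apply: open_nbhs_nbhs; split=> //.
    apply: (@open_comp _ _ f [set x | x != 0]) => [x _|]; first exact: cf.
    exact: open_neq.
  move=> /boxP[e e0 he].
  have : (mu2 (box z e) <= mu2 N)%E.
    apply: le_measure; rewrite ?inE//.
      exact: measurable_box.
    move=> u /he[Ku fu]; apply: fN => /= h; move/eqP: fu; apply.
    by have [] := h Ku.
  by rewrite N0 leNgt box_measure_gt0.
have [z Kz] := K0; have /boxP[e e0 he] : nbhs z K by apply: open_nbhs_nbhs.
apply: (peval_box_eq0 e0 (z := z)) => u /he /fK; rewrite /f.
move/eqP; rewrite paddr_eq0 ?sqr_ge0// !sqrf_eq0 => /andP[/eqP h1 /eqP h2].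
by apply/eqP; rewrite eq_complex h1 h2 !eqxx.
Qed.

End ComplexIntegral.

(** * Vanishing traces *)

Section TraceProperties.
Variables (R : realType) (m : nat) (a n : 'I_m -> R * R) (K : set (R * R)).
Hypotheses (polyK : is_polygon a K) (nK : unit_outward_normal a K n).
Local Notation C := R[i].
Local Notation rc := (real_complex R).
Local Notation mu := (@lebesgue_measure R).
Implicit Types (v : Pol R) (w : Pol R * Pol R).

Let lpK : local_polygon a n K := local_polygon_of polyK nK.

(** The polynomial [r * conjp r] then has integral [0] over the unit interval. *)
Lemma poly_ae_eq0 (r : {poly C}) :
  mu.-negligible [set t | 0 < t < 1 /\ r.[rc t] <> 0] -> r = 0.
Proof.
move=> rN; apply: pint_mul_conj_eq0; rewrite poly_mul_conj pint_map.
set s := Rep r ^+ 2 + Imp r ^+ 2.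
suff : ((pint s)%:E = 0)%E by move=> [->]; rewrite rmorph0.
have := @integral_deriv_poly R (prim s) 0 1 ler01.
rewrite deriv_prim prim0 subr0 -/(pint s) => <-.
have mD : measurable (`[0, 1] : set R) by exact: measurable_itv.
rewrite (ae_eq_integral (mu := mu) (cst 0%E)) ?integral0//.
- by apply/measurable_EFinP; exact: measurable_horner.
have Npt (x : R) : mu.-negligible [set x].
  by exists [set x]; split=> //; exact: lebesgue_measure_set1.
have := negligibleU (negligibleU (Npt 0) (Npt 1)) rN.
apply: negligibleS => t /= /not_implyP[]; rewrite in_itv/= => /andP[t0 t1] st.
have [->|t0'] := eqVneq t 0; first by left; left.
have [->|t1'] := eqVneq t 1; first by left; right.
right; split; first by rewrite !lt_neqAle eq_sym t0' t1' t0 t1.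
move=> rt; apply: st; congr EFin.
have : (r * conjp r).[rc t] = 0 by rewrite hornerM rt mul0r.
by rewrite poly_mul_conj horner_map => /(congr1 (@complex.Re R)).
Qed.

Lemma tang_horner j w t : (tang a n j w).[rc t] =
  - (rc (n j).2 * peval w.1 (ept a j t)) + rc (n j).1 * peval w.2 (ept a j t).
Proof. by rewrite /tang hornerD hornerN !hornerZ !restrE. Qed.

(** Take the cross product of the trace with [n]: since [n] is a unit vector, [n x (n x v)] is
    [- v], and the normal part of [w] drops out. *)
Lemma trc_eq0 v w : bnull (trc a n v w) -> forall j, tang a n j w = restr a j v.
Proof.
move=> h j; apply/eqP; rewrite -subr_eq0; apply/eqP/poly_ae_eq0.
apply: negligibleS (h j) => t /= [t01 ht]; split=> // e; apply: ht.
rewrite hornerD hornerN restrE tang_horner.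
have n1 : rc (n j).1 ^+ 2 + rc (n j).2 ^+ 2 = 1.
  by rewrite -!rmorphXn -rmorphD/= (lp_unit lpK) rmorph1.
move: e; rewrite /trc /ncross_s /ntan /= => -[].
set x := (n j).1%:C%C in n1 *; set y := (n j).2%:C%C in n1 *.
set V := peval v _; set W1 := peval w.1 _; set W2 := peval w.2 _ => e1 e2.
transitivity (- y * (y * V + (W1 - (x * W1 + y * W2) * x)) +
   x * (- (x * V) + (W2 - (x * W1 + y * W2) * y)) + ((x ^+ 2 + y ^+ 2) - 1) * V); first by ring.
by rewrite n1 subrr mul0r addr0 e1 e2 !mulr0 addr0.
Qed.

Lemma ntanE w : ntan a n w = trc a n 0 w.
Proof.
apply/funext => jt; rewrite /trc /=; apply/esym.
have -> : ncross_s a n 0 = 0.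
  by apply/funext => u; rewrite /ncross_s peval0 !mulr0 oppr0.
by rewrite add0r.
Qed.

Lemma ncrossE v : ncross_s a n v = trc a n v 0.
Proof.
rewrite /trc; have -> : ntan a n 0 = 0; last by rewrite addr0.
by apply/funext => u; rewrite /ntan /= peval0 !mulr0 !addr0 !mul0r subrr.
Qed.

Lemma ntan_eq0 w : bnull (ntan a n w) -> forall j, tang a n j w = 0.
Proof. by rewrite ntanE => h j; rewrite (trc_eq0 h) restr0. Qed.

Lemma ncross_eq0 v : bnull (ncross_s a n v) -> forall j, restr a j v = 0.
Proof.
rewrite ncrossE => h j; rewrite -(trc_eq0 h) /tang /= restr0.
by rewrite !scaler0 addr0 oppr0.
Qed.

Lemma green_tan0 v w : bnull (ntan a n w) -> ipS K (curl_v w) v = ipV K w (curl_s v).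
Proof.
move=> /ntan_eq0 h; apply/eqP; rewrite -subr_eq0 (green_curl lpK) big1// => j _.
by rewrite h mul0r pint0 mulr0.
Qed.

Lemma green_cross0 v w : bnull (ncross_s a n v) -> ipS K (curl_v w) v = ipV K w (curl_s v).
Proof.
move=> /ncross_eq0 h; apply/eqP; rewrite -subr_eq0 (green_curl lpK) big1// => j _.
by rewrite h conjp0 mulr0 pint0 mulr0.
Qed.

Lemma edge_len_gt0 j : 0 < edge_len a j.
Proof.
rewrite /edge_len sqrtr_gt0 lt_neqAle addr_ge0 ?sqr_ge0// andbT eq_sym.
rewrite paddr_eq0 ?sqr_ge0// !sqrf_eq0 !subr_eq0; apply/negP => /andP[/eqP e1 /eqP e2].
case: polyK => _ /(_ j) + _ _; apply.
by rewrite [LHS]surjective_pairing [RHS]surjective_pairing e1 e2.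
Qed.

(** By [trc_eq0] the boundary term is a sum of nonnegative integrals of [|v|^2] with positive
    weights, so each of them vanishes. *)
Lemma trc_eq0_cross v w : bnull (trc a n v w) ->
  ipS K (curl_v w) v = ipV K w (curl_s v) -> bnull (ncross_s a n v).
Proof.
move=> h /eqP; rewrite -subr_eq0 (green_curl lpK).
under eq_bigr => j _ do rewrite (trc_eq0 h).
rewrite psumr_eq0 => [/allP h0|j _]; last first.
  by rewrite mulr_ge0 ?pint_mul_conj_ge0// lecR ltW// edge_len_gt0.
move=> j; have : restr a j v = 0.
  have := h0 j (mem_index_enum _); rewrite mulf_eq0 => /orP[/eqP/(congr1 (@complex.Re R))/= e|/eqP].
    by have := edge_len_gt0 j; rewrite e ltxx.
  exact: pint_mul_conj_eq0.
move=> rv; rewrite [X in _.-negligible X](_ : _ = set0); first exact: negligible_set0.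
apply/seteqP; split=> // t /= [_]; apply.
by rewrite /ncross_s /= -restrE rv horner0 !mulr0 oppr0.
Qed.

(** Both partial derivatives vanish, so [v] is a constant, and its restriction to any one edge shows
    that it is [0]. *)
Lemma curl_cross_eq0 v : curl_s v = 0 -> bnull (ncross_s a n v) -> v = 0.
Proof.
move=> [dy /eqP]; rewrite oppr_eq0 => /eqP dx /ncross_eq0 h.
have j0 : 'I_m by case: polyK => m3 _ _ _; exact: (Ordinal (ltn_trans (isT : 0 < 2)%N m3)).
have C0 (i : nat) : i.+1%:R != 0 :> C by rewrite pnatr_eq0.
have P0 (i : nat) : i.+1%:R != 0 :> {poly C} by rewrite -polyC_natr polyC_eq0.
have v1 := deriv_eq0_polyC P0 dx.
have v2 : (v`_0)^`() = 0 by rewrite -coef_dY dy coef0.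
have v3 := deriv_eq0_polyC C0 v2.
have := h j0; rewrite v1 v3 restrC => /polyC_inj.
move=> e; rewrite e polyC0; exact: polyC0.
Qed.

Lemma subspace_bnull : subspace_set (@bnull R m _ : set (BF R m)).
Proof.
split=> [j|c x y hx hy j].
  rewrite [X in _.-negligible X](_ : _ = set0); first exact: negligible_set0.
  by apply/seteqP; split=> // t /= [_]; apply.
apply: negligibleS (negligibleU (hx j) (hy j)) => t /= [t01 h].
have [x0|] := pselect (x (j, t) = 0); last by left.
right; split=> // y0; apply: h.
by rewrite -[LHS]/(c *: x (j, t) + y (j, t)) x0 y0 scaler0 addr0.
Qed.

(** The normal condition at the midpoint of an edge yields points of [K]. *)
Lemma polygon_nonempty : K !=set0.
Proof.
have j0 : 'I_m by case: polyK => m3 _ _ _; exact: (Ordinal (ltn_trans (isT : 0 < 2)%N m3)).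
have [_ _ /(_ (1 / 2))] := nK j0; case; first by apply/andP; split; lra.
move=> e e0 /(_ (e / 2)) []; first by apply/andP; split; lra.
by move=> _ Kz; eexists; exact: Kz.
Qed.

Lemma ipV_eq0 w : ipV K w w = 0 -> w = 0.
Proof.
have oK : open K by case: polyK => _ _ _ [].
have K0 := polygon_nonempty.
have ge0 v : 0 <= ipS K v v by exact: ipS_ge0 lpK v.
rewrite /ipV => /eqP; rewrite paddr_eq0// => /andP[/eqP h1 /eqP h2].
have e1 := ipS_eq0 lpK oK K0 h1; have e2 := ipS_eq0 lpK oK K0 h2.
by rewrite [LHS]surjective_pairing e1 e2.
Qed.

End TraceProperties.

(** * Counting dimensions *)

(* [{poly {poly F}}] as a vector space over [F]; its canonical scalars are [{poly F}]. *)
Definition bipoly (F : comNzRingType) := {poly {poly F}}.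

Section Bipoly.
Variable F : comNzRingType.
HB.instance Definition _ := GRing.Zmodule.on (bipoly F).

Definition bipoly_scale (c : F) (p : bipoly F) : bipoly F := (c%:P%:P : {poly {poly F}}) * p.

Fact bipoly_scaleA a b p : bipoly_scale a (bipoly_scale b p) = bipoly_scale (a * b) p.
Proof. by rewrite /bipoly_scale mulrA -!polyCM. Qed.
Fact bipoly_scale1 : left_id 1 bipoly_scale.
Proof. by move=> p; rewrite /bipoly_scale mul1r. Qed.
Fact bipoly_scaleDr : right_distributive bipoly_scale +%R.
Proof. by move=> c p q; rewrite /bipoly_scale mulrDr. Qed.
Fact bipoly_scaleDl p : {morph bipoly_scale^~ p : a b / a + b}.
Proof. by move=> a b; rewrite /bipoly_scale !polyCD mulrDl. Qed.

HB.instance Definition _ := GRing.Zmodule_isLmodule.Build F (bipoly F)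
  bipoly_scaleA bipoly_scale1 bipoly_scaleDr bipoly_scaleDl.
End Bipoly.

Section SpanImage.
Variables (F : fieldType) (T T' : lmodType F) (f : T -> T').
Hypothesis fL : forall c x y, f (c *: x + y) = c *: f x + f y.

Lemma span_map s y : Defs.span (@GRing.scale F T') (map f s) y <->
  exists2 x, Defs.span (@GRing.scale F T) s x & y = f x.
Proof.
split=> [[c ->]|[_ [c ->] ->]].
  by exists (lincomb (@GRing.scale F T) s c); [exists c|rewrite linear_lincomb].
by exists c; rewrite linear_lincomb.
Qed.

Lemma dim_image_exists (S : set T) (Z' : set T') d : subspace_set Z' ->
    has_dim_mod (@GRing.scale F T) [set 0] S d ->
  exists d', has_dim_mod (@GRing.scale F T') Z' (f @` S) d'.
Proof.
move=> hZ' [[s [<- [sS hs]]] smax]; apply: (dim_mod_exists hZ' (s := map f s)).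
move=> _ [x Sx <-]; apply/span_map; exists x => //.
have [c /=] := indep_max_span (@subspace_set1 F T) sS hs smax Sx.
by move/eqP; rewrite subr_eq0 => /eqP ->; exists c.
Qed.

End SpanImage.

Lemma span_cat (F : fieldType) (T : lmodType F) (s t : seq T) x :
  Defs.span (@GRing.scale F T) (s ++ t) x <->
  exists y z, [/\ Defs.span (@GRing.scale F T) s y, Defs.span (@GRing.scale F T) t z & x = y + z].
Proof.
split=> [[c ->]|[_ [_ [[c ->] [c' ->] ->]]]].
  exists (lincomb (@GRing.scale F T) s c).
  exists (lincomb (@GRing.scale F T) t (fun i => c (size s + i)%N)).
  by split; [exists c|eexists; reflexivity|rewrite lincomb_cat].
exists (fun i => if (i < size s)%N then c i else c' (i - size s)%N).
rewrite lincomb_cat /=; congr (_ + _); apply: eq_lincomb => i hi; first by rewrite hi.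
by rewrite ltnNge leq_addr addKn.
Qed.

Section Decomposition.
Variables (R : realType) (m : nat) (a n : 'I_m -> R * R) (K : set (R * R)).
Hypotheses (polyK : is_polygon a K) (nK : unit_outward_normal a K n).
Variables (sV : seq (Pol R)) (sW : seq (Pol R * Pol R)).
Local Notation C := R[i].
(** The scalings [scP], [scW] and [scB] are convertible with those of the three modules, so the
    general lemmas apply to [spanP], [spanW] and [spanB]. *)
Let T1 : lmodType C := bipoly C.
Let T2 : lmodType C := (T1 * T1)%type.
Let T3 : lmodType C := BF R m.
Let lpK : local_polygon a n K := local_polygon_of polyK nK.
Let oK : open K. Proof. by case: polyK => _ _ _ []. Qed.
Local Notation null := (@bnull R m _ : set T3).

Let V : set T1 := spanP sV.
Let W : set T2 := spanW sW.
Let cs : T1 -> T2 := @curl_s R.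
Let cv : T2 -> T1 := @curl_v R.
Let ncr : T1 -> T3 := ncross_s a n.
Let nta : T2 -> T3 := ntan a n.
Let tr2 (u : T1 * T2) : T3 := trc a n u.1 u.2.
Let ip1 : T1 -> T1 -> C := ipS K.
Let ip2 : T2 -> T2 -> C := ipV K.

Let csL c x y : cs (c *: x + y) = c *: cs x + cs y.
Proof.
congr pair; first by rewrite dYD dY_scP.
by rewrite dXD dX_scP opprD /=; congr (_ + _); rewrite -mulrN.
Qed.

Let cvL c x y : cv (c *: x + y) = c *: cv x + cv y.
Proof.
rewrite /cv /curl_v /= dYD dY_scP dXD dX_scP.
rewrite [_ *: _](_ : _ = scP c (- dY x.1) + scP c (dX x.2)); last by exact: mulrDr.
have -> : scP c (- dY x.1) = - scP c (dY x.1) by exact: mulrN.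
by rewrite opprD addrACA.
Qed.

Let ncrL c x y : ncr (c *: x + y) = c *: ncr x + ncr y.
Proof.
apply/funext => jt; rewrite /ncr /ncross_s pevalD pevalZ.
by congr pair; rewrite /= /GRing.scale/=; ring.
Qed.

Let ntaL c x y : nta (c *: x + y) = c *: nta x + nta y.
Proof.
apply/funext => jt; rewrite /nta /ntan /= !pevalD !pevalZ.
by congr pair; rewrite /= /GRing.scale/=; ring.
Qed.

Let tr2E u : tr2 u = ncr u.1 + nta u.2. Proof. by []. Qed.

Let tr2L c x y : tr2 (c *: x + y) = c *: tr2 x + tr2 y.
Proof. by rewrite !tr2E /= ncrL ntaL scalerDr addrACA. Qed.

Let ip1L c x y z : ip1 (c *: x + y) z = c * ip1 x z + ip1 y z.
Proof. exact: (ipS_linear lpK). Qed.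

Let ip1C x y : ip1 x y = (ip1 y x)^*. Proof. exact: (ipSC lpK). Qed.

Let ip1_eq0 x : ip1 x x = 0 -> x = 0.
Proof. by apply: (ipS_eq0 lpK oK); exact: polygon_nonempty polyK nK. Qed.

Let ip2L c x y z : ip2 (c *: x + y) z = c * ip2 x z + ip2 y z.
Proof.
rewrite /ip2 /ipV -!/(ip1 _ _) /= !ip1L; ring.
Qed.

Let ip2C x y : ip2 x y = (ip2 y x)^*.
Proof. by rewrite /ip2 /ipV rmorphD/= -!(ipSC lpK). Qed.

Let ip2_eq0 x : ip2 x x = 0 -> x = 0.
Proof. exact: (ipV_eq0 polyK nK). Qed.

Let hV : subspace_set V. Proof. exact: (@subspace_span C T1). Qed.
Let hW : subspace_set W. Proof. exact: (@subspace_span C T2). Qed.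
Let hnull : subspace_set null. Proof. exact: subspace_bnull. Qed.

Let curlW := cv @` W.
Let curlV := cs @` V.
Let Y : set T1 := V `&` [set v | forall w, W w -> ip1 v (cv w) = 0].
Let X : set T2 := W `&` [set w | forall v, V v -> ip2 w (cs v) = 0].
Let W00 : set T2 := W `&` [set w | cv w = 0 /\ null (nta w)].

Let hcurlW : subspace_set curlW. Proof. exact: subspace_image. Qed.
Let hcurlV : subspace_set curlV. Proof. exact: subspace_image. Qed.

Let hY : subspace_set Y.
Proof.
apply: subspace_setI => //; split=> [w _|c x y hx hy w Ww]; first exact: ip0l.
by rewrite ip1L hx// hy// mulr0 addr0.
Qed.

Let hX : subspace_set X.
Proof.
apply: subspace_setI => //; split=> [w _|c x y hx hy w Ww]; first exact: ip0l.
by rewrite ip2L hx// hy// mulr0 addr0.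
Qed.

Let hW00 : subspace_set W00.
Proof.
apply: subspace_setI => //.
apply: (@subspace_setI _ _ (cv @^-1` [set 0]) (nta @^-1` null)).
  exact: (subspace_preimage cvL (@subspace_set1 _ _)).
exact: (subspace_preimage ntaL hnull).
Qed.

Let Vspan x : V x -> Defs.span (@GRing.scale C T1) sV x. Proof. by []. Qed.
Let Wspan x : W x -> Defs.span (@GRing.scale C T2) sW x. Proof. by []. Qed.

Let curlWP y : Defs.span (@GRing.scale C T1) (map cv sW) y <-> curlW y.
Proof.
split=> [/(span_map cvL)[x Wx ->]|[x Wx <-]]; first by exists x.
by apply/(span_map cvL); exists x.
Qed.

Let curlVP y : Defs.span (@GRing.scale C T2) (map cs sV) y <-> curlV y.
Proof.
split=> [/(span_map csL)[x Wx ->]|[x Wx <-]]; first by exists x.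
by apply/(span_map csL); exists x.
Qed.

(** Green's formula without boundary term; hence [W00] is contained in [X]. *)
Lemma W00_perp w v : W00 w -> ip2 w (cs v) = 0.
Proof.
move=> [_ [cw nw]]; rewrite /ip2 /cs -(green_tan0 polyK nK v nw).
by rewrite -[curl_v w]/(cv w) cw; exact: (ip0l ip1L).
Qed.

Hypotheses (csV : forall v, V v -> W (cs v)) (cvW : forall w, W w -> V (cv w)).

Lemma trace_kernel v w : Y v -> X w -> null (tr2 (v, w)) -> v = 0 /\ W00 w.
Proof.
move=> [Vv Yv] [Ww Xw] h.
have e : ip1 (cv w) v = ip2 w (cs v) by rewrite ip1C Yv// conjC0 Xw.
have nv : null (ncr v) := trc_eq0_cross polyK nK h e.
have v0 : v = 0.
  (* Green's formula with [w := cs v], which lies in [W]: the squared norm of [cs v] is the product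
     of [cv (cs v)] with [v], and [v] is orthogonal to [curlW]. *)
  apply: (curl_cross_eq0 polyK nK) => //; apply: ip2_eq0.
  rewrite /ip2 -(green_cross0 polyK nK _ nv) -/(ip1 _ _) ip1C Yv ?conjC0//.
  exact: csV.
split=> //; rewrite v0 in h.
have nw : null (nta w) by rewrite /nta ntanE.
(* Likewise with [v := cv w], which lies in [V]. *)
split=> //; split=> //; apply: ip1_eq0.
rewrite /ip1 /cv (green_tan0 polyK nK _ nw) -/(cv w).
by apply: Xw; exact: cvW.
Qed.

(** Let [V0] and [W0] be the kernels of the curls. Then [dim V = dim V0 + dim curlV = dim Y + dim
    curlW] and [dim W = dim W0 + dim curlW = dim X + dim curlV], so
    [dim Y + dim X = dim V0 + dim W0]. The trace is injective on [V0] and has kernel [W00] on [W0],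
    so this sum is [dA + dB + dim W00]; and [W00] is also the kernel of the trace on the product of
    [Y] and [X]. *)
Lemma dim_trace dA dB :
    has_dim_mod (@GRing.scale C T3) null (ncr @` (V `&` cs @^-1` [set 0])) dA ->
    has_dim_mod (@GRing.scale C T3) null (nta @` (W `&` cv @^-1` [set 0])) dB ->
  has_dim_mod (@GRing.scale C T3) null (tr2 @` (Y `*` X)) (dA + dB).
Proof.
move=> hA hB.
have h1 := @subspace_set1 C T1; have h2 := @subspace_set1 C T2.
have exV S : (forall x, S x -> V x) -> exists d, has_dim_mod (@GRing.scale C T1) [set 0] S d.
  by move=> SV; apply: (dim_mod_exists h1 (s := sV)) => x /SV.
have exW S : (forall x, S x -> W x) -> exists d, has_dim_mod (@GRing.scale C T2) [set 0] S d.
  by move=> SW; apply: (dim_mod_exists h2 (s := sW)) => x /SW.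
have [dV hdV] := exV V (fun _ => id).
have [dW hdW] := exW W (fun _ => id).
have [dV0 hdV0] := exV (V `&` cs @^-1` [set 0]) (fun _ => @proj1 _ _).
have [dW0 hdW0] := exW (W `&` cv @^-1` [set 0]) (fun _ => @proj1 _ _).
have [dY hdY] := exV Y (fun _ => @proj1 _ _).
have [dX hdX] := exW X (fun _ => @proj1 _ _).
have [d00 hd00] := exW W00 (fun _ => @proj1 _ _).
have [dcV hdcV] := dim_image_exists csL h2 hdV.
have [dcW hdcW] := dim_image_exists cvL h1 hdW.
have e1 : dV = (dV0 + dcV)%N.
  exact: (dim_mod_uniq hdV (rank_nullity csL hV h2 hdV0 hdcV)).
have e2 : dW = (dW0 + dcW)%N.
  exact: (dim_mod_uniq hdW (rank_nullity cvL hW h1 hdW0 hdcW)).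
have hV0 : subspace_set (V `&` cs @^-1` [set 0]).
  by apply: subspace_setI => //; exact: (subspace_preimage csL h2).
have hW0 : subspace_set (W `&` cv @^-1` [set 0]).
  by apply: subspace_setI => //; exact: (subspace_preimage cvL h1).
have e3 : dV0 = dA.
  apply: (dim_mod_uniq hdV0); rewrite -[dA]add0n.
  apply: (rank_nullity ncrL hV0 hnull) => //.
  suff -> : V `&` cs @^-1` [set 0] `&` ncr @^-1` null = [set 0] by exact: dim_set0.
  apply/seteqP; split=> [x [[_ cx] nx]|_ ->]; first exact: (curl_cross_eq0 polyK nK).
  split; first by case: hV0.
  by have [] := subspace_preimage ncrL hnull.
have e4 : dW0 = (d00 + dB)%N.
  apply: (dim_mod_uniq hdW0); apply: (rank_nullity ntaL hW0 hnull) => //.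
  suff -> : W `&` cv @^-1` [set 0] `&` nta @^-1` null = W00 by [].
  by rewrite -setIA.
have e5 : dV = (dY + dcW)%N.
  apply: (dim_direct_sum hY hcurlW _ _ hdV hdY hdcW) => [x|x [_ Yx] [w Ww xw]]; last first.
    by apply: ip1_eq0; rewrite -[X in ip1 _ X]xw Yx.
  split=> [Vx|[y [z [[Vy _] [w Ww <-] ->]]]]; last by apply: subspace_setD => //; exact: cvW.
  have [y /curlWP yW yo] := orthogonal_projection ip1L ip1C ip1_eq0 (map cv sW) x.
  exists (x - y), y; split => //; last by rewrite subrK.
  split; first by apply: subspace_setB => //; case: yW => w Ww <-; exact: cvW.
  by move=> w Ww; apply: yo; apply/curlWP; exists w.
have e6 : dW = (dX + dcV)%N.
  apply: (dim_direct_sum hX hcurlV _ _ hdW hdX hdcV) => [x|x [_ Xx] [w Ww xw]]; last first.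
    by apply: ip2_eq0; rewrite -[X in ip2 _ X]xw Xx.
  split=> [Vx|[y [z [[Vy _] [w Ww <-] ->]]]]; last by apply: subspace_setD => //; exact: csV.
  have [y /curlVP yW yo] := orthogonal_projection ip2L ip2C ip2_eq0 (map cs sV) x.
  exists (x - y), y; split => //; last by rewrite subrK.
  split; first by apply: subspace_setB => //; case: yW => w Ww <-; exact: csV.
  by move=> w Ww; apply: yo; apply/curlVP; exists w.
have hXY : subspace_set (Y `*` X).
  split; first by split; [case: hY|case: hX].
  by move=> c [x x'] [y y'] [/= ? ?] [/= ? ?]; split; [case: hY => _ h|case: hX => _ h]; exact: h.
have hdXY := dim_setX hY hX hdY hdX.
have [dT hdT] := dim_image_exists tr2L hnull hdXY.
have ker : Y `*` X `&` tr2 @^-1` null = [set 0] `*` W00.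
  apply/seteqP; split=> [[v w] [[/= Yv Xw] nvw]|[v w] [/= -> Ww]].
    by have [-> ?] := trace_kernel Yv Xw nvw.
  split; first split => /=; [by case: hY| |].
    by split; [case: Ww|move=> v' _; exact: W00_perp].
  by case: Ww => _ [_]; rewrite /preimage/= /tr2 /= -ntanE.
have hdk := dim_setX h1 hW00 (dim_set0 T1) hd00.
have := dim_mod_uniq hdXY.
move=> /(_ _ (rank_nullity tr2L hXY hnull _ hdT)); rewrite ker => /(_ _ hdk) e7.
by have -> : (dA + dB = dT)%N by lia.
Qed.

Variable sM : seq (BF R m).
Let M : set T3 := spanB sM.
Hypotheses (ncrM : forall v, V v -> inM sM (ncr v)) (ntaM : forall w, W w -> inM sM (nta w)).

Let hM : subspace_set M. Proof. exact: (@subspace_span C T3). Qed.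

Lemma trace_inM v w : V v -> W w -> inM sM (tr2 (v, w)).
Proof.
move=> /ncrM[f Mf hf] /ntaM[g Mg hg]; exists (f + g); first exact: subspace_setD.
rewrite tr2E /= opprD addrACA; exact: (subspace_setD hnull hf hg).
Qed.

(** The image of the trace lies in [M] modulo null functions and has dimension [dA + dB] in any
    case. The index thus measures its codimension in [M]. *)
Lemma index_zero_iff_trace_onto : M_index_zero a n sV sW sM <->
  (forall mu, M mu -> exists2 u, (Y `*` X) u & null (mu - tr2 u)).
Proof.
have AE : [set f | exists2 v, spanP sV v /\ curl_s v = 0 & f = ncross_s a n v] =
    ncr @` (V `&` cs @^-1` [set 0]).
  by apply/seteqP; split=> f [v hv e]; exists v.
have BE : [set f | exists2 w, spanW sW w /\ curl_v w = 0 & f = ntan a n w] =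
    nta @` (W `&` cv @^-1` [set 0]).
  by apply/seteqP; split=> f [v hv e]; exists v.
rewrite /M_index_zero AE BE.
have trM : tr2 @` (Y `*` X) `<=` saturation null M.
  by move=> _ [[v w] [[Vv _] [Ww _]] <-]; exact: trace_inM.
have hXY : subspace_set (Y `*` X).
  split; first by split; [case: hY|case: hX].
  by move=> c [x x'] [y y'] [/= ? ?] [/= ? ?]; split; [case: hY => _ h|case: hX => _ h]; exact: h.
have htr : subspace_set (tr2 @` (Y `*` X)) by exact: subspace_image.
split=> [[dM [dA [dB [hdM hdA hdB e]]]] mu Mmu|onto].
  have hdT := dim_trace hdA hdB.
  have eM : dM = (dA + dB)%N by lia.
  rewrite eM in hdM.
  by have [_ [u ? <-] ?] := dim_eq_sub hnull trM hdT hdM htr Mmu; exists u.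
have [dV0 hdV0] : exists d, has_dim_mod (@GRing.scale C T1) [set 0] (V `&` cs @^-1` [set 0]) d.
  by apply: (dim_mod_exists (@subspace_set1 C T1) (s := sV)) => x [/Vspan].
have [dW0 hdW0] : exists d, has_dim_mod (@GRing.scale C T2) [set 0] (W `&` cv @^-1` [set 0]) d.
  by apply: (dim_mod_exists (@subspace_set1 C T2) (s := sW)) => x [/Wspan].
have [dA hdA] := dim_image_exists ncrL hnull hdV0.
have [dB hdB] := dim_image_exists ntaL hnull hdW0.
have [dM hdM] : exists d, has_dim_mod (@GRing.scale C T3) null M d.
  by apply: (dim_mod_exists hnull (s := sM)) => x.
have hdT := dim_trace hdA hdB.
exists dM, dA, dB; split => //.
suff -> : dM = (dA + dB)%N by lia.
apply: (dim_saturation_eq hnull _ hdM hdT); apply/seteqP; split=> f [g Mg fg].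
  have [u Yu gu] := onto g Mg; exists (tr2 u); first by exists u.
  by rewrite -(subrK g f) -addrA; exact: (subspace_setD hnull fg gu).
have [h Mh gh] := trM g Mg; exists h => //.
by rewrite -(subrK g f) -addrA; exact: (subspace_setD hnull fg gh).
Qed.

(** Adding [W00] to [curlV] removes the kernel of the trace from the complement, and the image stays
    the same because [W00] has null trace. *)
Lemma decomposition_of_trace_onto :
    (forall mu, M mu -> exists2 u, (Y `*` X) u & null (mu - tr2 u)) ->
  exists sVt : seq (Pol R), exists sWt : seq (Pol R * Pol R),
    [/\ (forall v, spanP sVt v -> V v) /\ (forall w, spanW sWt w -> W w),
        (forall v, V v -> spanW sWt (curl_s v)),
        (forall w, W w -> spanP sVt (curl_v w)),
        (forall v w, perpS K sV sVt v -> perpV K sW sWt w ->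
           bnull (trc a n v w) -> v = 0 /\ w = 0) &
        (forall mu, M mu -> exists v, exists w,
           [/\ perpS K sV sVt v, perpV K sW sWt w & bnull (trc a n v w - mu)])].
Proof.
move=> onto.
have [d00 [[s00 [s00d [s00W s00i]]] s00max]] :
    exists d, has_dim_mod (@GRing.scale C T2) [set 0] W00 d.
  by apply: (dim_mod_exists (@subspace_set1 C T2) (s := sW)) => x [/Wspan].
have W00P w : W00 w <-> Defs.span (@GRing.scale C T2) s00 w.
  split=> [Ww|[c ->]]; last exact: lincomb_in.
  have [|c /= /eqP] := indep_max_span (@subspace_set1 C T2) s00W s00i _ Ww.
    by move=> t tW ti; rewrite s00d; exact: s00max.
  by rewrite subr_eq0 => /eqP ->; exists c.
have WtP w : spanW (map cs sV ++ s00) w <-> exists y z, [/\ curlV y, W00 z & w = y + z].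
  split=> [/(@span_cat _ T2)[y [z [/curlVP hy /W00P hz ->]]]|[y [z [/curlVP hy /W00P hz ->]]]].
    by exists y, z.
  by apply/(@span_cat _ T2); exists y, z.
have W00_0 : W00 0 by case: hW00.
have curlV0 : curlV 0 by case: hcurlV.
have perpY v : perpS K sV (map cv sW) v -> Y v.
  by move=> [Vv h]; split=> // w Ww; apply: h; apply/curlWP; exists w.
have perpX w : perpV K sW (map cs sV ++ s00) w -> X w /\ forall z, W00 z -> ip2 w z = 0.
  move=> [Ww h]; split; first split=> // v Vv.
    by apply: h; apply/WtP; exists (cs v), 0; split=> //; [exists v|rewrite addr0].
  by move=> z W0z; apply: h; apply/WtP; exists 0, z; split=> //; rewrite add0r.
exists (map cv sW), (map cs sV ++ s00); split.
- split=> [v /curlWP[w Ww <-]|w /WtP[y [z [[v Vv <-] [Wz _] ->]]]]; first exact: cvW.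
  by apply: subspace_setD => //; exact: csV.
- by move=> v Vv; apply/WtP; exists (cs v), 0; split=> //; [exists v|rewrite addr0].
- by move=> w Ww; apply/curlWP; exists w.
- move=> v w /perpY Yv /perpX[Xw wo] h.
  have [v0 W0w] := trace_kernel Yv Xw h; split=> //.
  by apply: ip2_eq0; exact: wo.
move=> mu Mmu; have [[v w] [[Vv Yv] [Ww Xw]] h] := onto mu Mmu.
(* Subtracting [p] makes [w] orthogonal to [W00], keeps it orthogonal to [curlV] by [W00_perp], and
   changes its trace by a null function only. *)
have [p /W00P W0p wp] := orthogonal_projection ip2L ip2C ip2_eq0 s00 w.
exists v, (w - p); split.
- by split=> // u /curlWP[w' Ww' <-]; exact: Yv.
- split; first by apply: subspace_setB => //; case: W0p.
  move=> z /WtP[y [z' [[v' Vv' <-] /W00P hz' ->]]].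
  rewrite -/(ip2 _ _) (ipDr ip2L ip2C) (wp z' hz') addr0 (ipBl ip2L).
  by rewrite Xw// W00_perp// subrr.
- have nmu := subspace_setZ (-1) hnull h.
  have [_ [_ np]] := W0p; have := subspace_setB hnull nmu np.
  rewrite [X in null X -> _](_ : _ = tr2 (v, w - p) - mu)//.
  rewrite !tr2E /= (linear_sub ntaL) scaleN1r opprB.
  by rewrite addrAC addrA.
Qed.

End Decomposition.

Theorem theorem3p2 (R : realType) (m : nat) (K : set (R * R))
    (a n : 'I_m -> R * R)
    (sV : seq (Pol R)) (sW : seq (Pol R * Pol R)) (sM : seq (BF R m)) :
  is_polygon a K ->
  unit_outward_normal a K n ->
  (forall i, (i < size sM)%N -> L2_edges sM`_i) ->
  M_decomposition a n K sV sW sM <->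
  [/\ (* (i) *)
      (forall v, spanP sV v -> inM sM (ncross_s a n v)) /\
      (forall w, spanW sW w -> inM sM (ntan a n w)),
      (* (ii) *)
      (forall v, spanP sV v -> spanW sW (curl_s v)) /\
      (forall w, spanW sW w -> spanP sV (curl_v w)),
      (* (iii) *)
      M_index_zero a n sV sW sM &
      (* (iv) *)
      (forall mu, spanB sM mu -> bnull (ncross_b n mu) -> bnull mu)].
Proof.
move=> polyK nK _; split=> [[[i1 i2] [sVt [sWt [[tV tW] csVt cvWt _ onto]]] iv]|].
  have csV v : spanP sV v -> spanW sW (curl_s v) by move/csVt/tW.
  have cvW w : spanW sW w -> spanP sV (curl_v w) by move/cvWt/tV.
  split=> //; apply/(index_zero_iff_trace_onto polyK nK csV cvW i1 i2) => mu /onto.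
  move=> [v [w [[Vv vo] [Ww wo] h]]]; exists (v, w).
    by split; split=> //; [move=> w' /cvWt; exact: vo|move=> v' /csVt; exact: wo].
  by have := subspace_setZ (-1) (subspace_bnull R m) h; rewrite scaleN1r opprB.
move=> [[i1 i2] [csV cvW] /(index_zero_iff_trace_onto polyK nK csV cvW i1 i2) onto iv].
by split=> //; exact: (decomposition_of_trace_onto polyK nK csV cvW onto).
Qed.
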